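(* For every integer $k\ge 1$, the function $A_k(q)$ lies in the ring of quasi-modular forms (for the full modular group $PSL_2(\mathbb{Z})$), i.e. in the ring generated over $\mathbb{C}$ by the Eisenstein series $E_2(q)$, $E_4(q)$ and $E_6(q)$.
   Context: For an integer $k\ge 1$ (sum over integers $m_1,\dots,m_k$), $$A_k(q) = \sum_{0<m_1 < \cdots < m_k}\frac{q^{m_1 + \cdots + m_k}}{(1 - q^{m_1})^2 \cdots (1 - q^{m_k})^2}.$$ The Eisenstein series are given by their $q$-expansions $$E_{2j}(q) = 1 + \frac{2}{\zeta(1 - 2j)}\sum_{n=1}^\infty \sigma_{2j-1}(n)q^n,\qquad \sigma_r(n)=\sum_{d\mid n} d^r,$$ where $\zeta$ is the Riemann zeta function; in particular $E_2 = 1-24\sum_{n\ge1}\sigma_1(n)q^n$, $E_4=1+240\sum_{n\ge1}\sigma_3(n)q^n$, $E_6=1-504\sum_{n\ge1}\sigma_5(n)q^n$. The ring of quasi-modular forms is the ring generated by $E_2,E_4,E_6$ (elements may be of mixed weight); elements are identified with their $q$-expansions. *)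

(* Defs.v *)
(* Library world: MathComp and MathComp-Analysis. *)
From HB Require Import structures.
From mathcomp Require Import all_boot all_order all_algebra.
From mathcomp Require Import all_classical all_reals all_analysis.
From mathcomp Require Import complex.
From mathcomp Require summability.

Set Implicit Arguments.
Unset Strict Implicit.
Unset Printing Implicit Defensive.

Import Order.TTheory GRing.Theory Num.Theory.
Import numFieldNormedType.Exports.

Local Open Scope classical_set_scope.
Local Open Scope ring_scope.
Local Open Scope complex_scope.

Definition unit_disc (R : realType) : Type := {q : R[i] | `|q| < 1}.

(* The type of (m_1, ..., m_k) with 0 < m_1 < ... < m_k. *)
Definition increasing_tuple (k : nat) : choiceType :=
  {m : k.-tuple nat | path ltn 0%N m}.

(* [summability.sum] is unordered summation: the limit of the finite partial
   sums along the directed set of finite subsets of the index type.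
   [R[i]^o] is the complex line with its standard norm and topology. *)
Definition MacMahonA (R : realType) (k : nat) (q : unit_disc R) : R[i] :=
  summability.sum (fun m : increasing_tuple k =>
    \prod_(j < k) (val q ^+ tnth (val m) j / (1 - val q ^+ tnth (val m) j) ^+ 2)
    : R[i]^o).

Definition divisor_sigma (r n : nat) : nat := (\sum_(d <- divisors n) d ^ r)%N.

(* 1 + c * \sum_(n >= 1) sigma_r(n) q^n *)
Definition eisenstein_series (R : realType) (c : R[i]) (r : nat)
    (q : unit_disc R) : R[i] :=
  1 + c * limn (fun N : nat =>
    \sum_(1 <= n < N) (divisor_sigma r n)%:R * val q ^+ n : R[i]^o).

(* The constants are 2 / zeta(1 - 2j) for j = 1, 2, 3, where
   zeta(-1) = -1/12, zeta(-3) = 1/120 and zeta(-5) = -1/252. *)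
Definition E2 (R : realType) : unit_disc R -> R[i] :=
  eisenstein_series (- 24%:R) 1.
Definition E4 (R : realType) : unit_disc R -> R[i] :=
  eisenstein_series 240%:R 3.
Definition E6 (R : realType) : unit_disc R -> R[i] :=
  eisenstein_series (- 504%:R) 5.

(* The C-subalgebra, generated by E2, E4 and E6, of the algebra of complex
   functions on the unit disc with pointwise operations (closure under
   opposites is multiplication by the constant -1). *)
Inductive quasimodular (R : realType) : (unit_disc R -> R[i]) -> Prop :=
| quasimodular_cst (c : R[i]) : quasimodular (fun=> c)
| quasimodular_E2 : quasimodular (@E2 R)
| quasimodular_E4 : quasimodular (@E4 R)
| quasimodular_E6 : quasimodular (@E6 R)
| quasimodular_add (f g : unit_disc R -> R[i]) :
    quasimodular f -> quasimodular g -> quasimodular (fun q => f q + g q)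
| quasimodular_mul (f g : unit_disc R -> R[i]) :
    quasimodular f -> quasimodular g -> quasimodular (fun q => f q * g q).

(* Main.v *)
Require Import Defs.
From mathcomp Require Import all_boot all_order all_algebra.
From mathcomp Require Import all_classical all_reals all_analysis.
From mathcomp Require Import complex finmap ring zify.
From mathcomp Require summability.

Set Implicit Arguments.
Unset Strict Implicit.
Unset Printing Implicit Defensive.

Import Order.TTheory GRing.Theory Num.Theory.
Import numFieldNormedType.Exports.

(** Put u_m = q^m / (1 - q^m)^2.  The function A_k is the k-th elementary
symmetric function of u_1, u_2, ..., so Newton's identities express it as a
polynomial in the power sums P_i = sum_m u_m^i.  In the expansion
x^i / (1 - x)^(2i) = sum_n C(n + i - 1, 2i - 1) x^n the coefficient is an odd
polynomial in n; substituting x = q^m and summing over m makes P_i a linear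
combination of the Lambert series
  S_r = sum_{a, x >= 1} a^r q^(a x) = sum_{n >= 1} sigma_r(n) q^n
with r odd.  Up to affine changes S_1, S_3 and S_5 are E2, E4 and E6, so it
remains to express S_r, for odd r >= 7, as a polynomial in those of smaller odd
index ([power_lambert_relation], [quasimodular_power_lambert]).

This last step is usually read off the differential equation of the Weierstrass
function; here it comes from a rearrangement of absolutely convergent sums.  For
a function F of two integers let
  T(F) = sum_{a, b, x, y >= 1} F(a, b) q^(a x + b y).
Assume that F is symmetric, that G(a, a + c) = F(a, c) for a symmetric G, and
that G(a, a) = 0.  Splitting T(F) according to the order of x and y, and T(G)
according to the order of a and b, and using
  a (x + y) + b y = a x + (a + b) y,
one finds the same series U twice in both, and
  T(F) - T(G) = sum_{a, b, x >= 1} F(a, b) q^((a + b) x)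
([double_lambert_exchange]).  The binary form
  F(a, b) = (a b (a + b))^2 (a^2 + a b + b^2)^m
is invariant under the exchange of a and b, under (a, b) -> (- a, - b) and under
(a, b) -> (a, - a - b), so F and G(a, b) = F(a, - b) satisfy the hypotheses.  The
difference F - G keeps the monomials of F that are odd in each variable, so the
left-hand side is a combination of products S_i S_j with i + j = 2m + 6 and
i, j >= 3 odd.  The right-hand side is the Lambert series with coefficients
  R(n) = sum_{a + b = n} F(a, b).
Written in the centred variable a - b, this sum is seen to be an odd polynomial
in n of degree exactly 2m + 7 ([dihedral_form_sum_poly]).  Solving for the top
term expresses S_(2m+7) through S_1, S_3, ..., S_(2m+5).

All rearrangements are carried out with unordered sums, for which absolute
convergence gives reindexing, products and summation by fibres
([has_sum_fiber]). *)

Local Open Scope fset_scope.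
Local Open Scope ring_scope.
Local Open Scope complex_scope.

(** * Unordered summation of absolutely summable complex families *)

Lemma ler_sum_fset (K : numDomainType) (I : choiceType) (f : I -> K)
    (A B : {fset I}) :
  A `<=` B -> (forall i, 0 <= f i) -> \sum_(i <- A) f i <= \sum_(i <- B) f i.
Proof.
move=> AB f0; rewrite [leRHS](big_fsetID _ (mem A)) /=.
have -> : [fset x in B | x \in A] = A.
  by apply/fsetP => x; rewrite !inE /=; apply/andb_idl/(fsubsetP AB).
by rewrite lerDl sumr_ge0.
Qed.

Section Summation.
Variable R : realType.
Local Notation C := R[i].

(** Convergence along the directed set of finite subsets, in the epsilon form that
comparisons of finite sets use. *)
Definition has_sum (I : choiceType) (f : I -> C) (s : C) : Prop :=
  forall e : C, 0 < e -> exists A : {fset I}, forall B : {fset I},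
    A `<=` B -> `|s - \sum_(i <- B) f i| < e.

Definition abs_summable (I : choiceType) (f : I -> C) : Prop :=
  exists M : C, forall A : {fset I}, \sum_(i <- A) `|f i| <= M.

Definition tsum (I : choiceType) (f : I -> C) : C :=
  summability.sum (f : I -> C^o).

Lemma partial_sumE (I : choiceType) (f : I -> C) (A : {fset I}) :
  summability.partial_sum (f : I -> C^o) A = \sum_(i <- A) f i.
Proof. by rewrite /summability.partial_sum big_seq_fsetE. Qed.

Lemma has_sum_tsum (I : choiceType) (f : I -> C) (s : C) :
  has_sum f s -> tsum f = s.
Proof.
move=> fs; have FF := @summability.totally_filter I.
apply: (@cvg_lim C^o) => //.
apply/cvgrPdist_lt => e e0.
have [A hA] := fs e e0.
exists A => // B /= AB.
by rewrite partial_sumE; exact: hA.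
Qed.

Lemma eq_has_sum (I : choiceType) (f g : I -> C) (s : C) :
  f =1 g -> has_sum f s -> has_sum g s.
Proof. by move=> /funext ->. Qed.

Lemma has_sumD (I : choiceType) (f g : I -> C) (s t : C) :
  has_sum f s -> has_sum g t -> has_sum (fun i => f i + g i) (s + t).
Proof.
move=> fs gt e e0; have e2 : 0 < e / 2 by rewrite divr_gt0.
have [A hA] := fs _ e2; have [B hB] := gt _ e2.
exists (A `|` B) => D; rewrite fsubUset => /andP[AD BD].
rewrite big_split /= opprD addrACA.
rewrite (le_lt_trans (ler_normD _ _))// [ltRHS]splitr.
by rewrite ltrD ?hA ?hB.
Qed.

Lemma has_sumZ (I : choiceType) (f : I -> C) (s c : C) :
  has_sum f s -> has_sum (fun i => c * f i) (c * s).
Proof.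
move=> fs e e0; have c0 : 0 < `|c| + 1 by rewrite ltr_wpDl.
have [A hA] := fs (e / (`|c| + 1)) (divr_gt0 e0 c0).
exists A => B AB; rewrite -mulr_sumr -mulrBr normrM.
have := hA B AB; rewrite ltr_pdivlMr// => /(le_lt_trans _); apply.
by rewrite mulrC ler_wpM2l// lerDl.
Qed.

Lemma has_sum_finite (I : choiceType) (f : I -> C) (A : {fset I}) :
  (forall i, i \notin A -> f i = 0) -> has_sum f (\sum_(i <- A) f i).
Proof.
move=> f0 e e0; exists A => B AB.
by rewrite (big_fset_incl _ AB) ?subrr ?normr0// => i _ /f0.
Qed.

(** A bounded increasing net of reals converges to its supremum. *)
Lemma has_sum_nonneg (I : choiceType) (f : I -> R) (M : R) :
  (forall i, 0 <= f i) -> (forall A : {fset I}, \sum_(i <- A) f i <= M) ->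
  exists s : C, has_sum (fun i => (f i)%:C) s.
Proof.
move=> f0 fM.
pose S : set R := [set \sum_(i <- A) f i | A in [set: {fset I}]]%classic.
have supS : has_sup S.
  split; first by exists (\sum_(i <- fset0) f i); exists fset0.
  by exists M => _ [A _ <-].
exists (sup S)%:C => e e0.
have [e' e'0 ->] : exists2 e' : R, 0 < e' & e = e'%:C.
  exists (complex.Re e); last by rewrite RRe_real ?gtr0_real.
  by move: e0; rewrite ltcE => /andP[].
have [_ [A _ <-] hA] := sup_adherent e'0 supS.
exists A => B AB.
rewrite -rmorph_sum -rmorphB /= normc_def /= expr0n addr0 sqrtr_sqr ltcR.
have hB : \sum_(i <- B) f i <= sup S.
  by apply: ub_le_sup; [case: supS|exists B].
rewrite ger0_norm ?subr_ge0// ltrBlDl -ltrBlDr.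
exact: lt_le_trans hA (ler_sum_fset AB f0).
Qed.

(** Each of the real and imaginary parts p is the difference of the nonnegative
families |p| + p and |p|, which are bounded by 2 |f| and |f|. *)
Lemma abs_summable_has_sum (I : choiceType) (f : I -> C) :
  abs_summable f -> has_sum f (tsum f).
Proof.
move=> [M fM].
pose n (z : C) := complex.Re `|z|.
have nE z : (n z)%:C = `|z| by rewrite RRe_real ?normr_real.
have [M' fM'] : exists M' : R, forall A : {fset I}, \sum_(i <- A) n (f i) <= M'.
  exists (complex.Re M) => A; have := fM A.
  rewrite lecE => /andP[_]; apply: le_trans.
  by rewrite raddf_sum.
have pos (p : C -> R) : (forall z, `|p z| <= n z) ->
    exists s : C, has_sum (fun i => (p (f i))%:C) s.
  move=> pn.
  have [s hs] : exists s : C, has_sum (fun i => `|p (f i)|%:C) s.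
    apply: (@has_sum_nonneg _ _ M') => // A.
    by apply: le_trans (fM' A); apply: ler_sum.
  have [t ht] : exists t : C, has_sum (fun i => (`|p (f i)| + p (f i))%:C) t.
    apply: (@has_sum_nonneg _ _ (M' + M')) => [i|A].
      by rewrite -lerBlDr sub0r -normrN ler_norm.
    rewrite big_split /= lerD//.
      by apply: le_trans (fM' A); apply: ler_sum.
    apply: le_trans (fM' A); apply: ler_sum => i _.
    exact: le_trans (ler_norm _) (pn _).
  exists (t + (-1) * s).
  apply: eq_has_sum (has_sumD ht (has_sumZ (-1) hs)) => i.
  by rewrite rmorphD /=; ring.
have nRe z : `|complex.Re z| <= n z by have := normc_ge_Re z; rewrite -nE lecR.
have nIm z : `|complex.Im z| <= n z.
  have := nRe (z * 'i); rewrite ReiNIm normrN /n normrM.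
  have -> : `|'i : C| = 1 by rewrite normc_def /= expr0n expr1n add0r sqrtr1.
  by rewrite mulr1.
have [s hs] := pos _ nRe; have [t ht] := pos _ nIm.
have h : has_sum f (s + 'i * t).
  apply: eq_has_sum (has_sumD hs (has_sumZ 'i ht)) => i.
  by rewrite [RHS]complexE.
by rewrite (has_sum_tsum h).
Qed.

Lemma sum_fset_eq (J : choiceType) (B : {fset J}) (j : J) (c : C) :
  \sum_(k <- B) (if j == k then c else 0) = if j \in B then c else 0.
Proof.
case: ifPn => [jB|jB].
  rewrite (big_fsetD1 j) //= eqxx big1_seq ?addr0// => k.
  by rewrite !inE eq_sym => /andP[_ /andP[/negbTE ->]].
rewrite big1_seq // => k /andP[_ kB]; case: eqP => // jk.
by rewrite jk kB in jB.
Qed.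

Definition fset_iota (n : nat) : {fset nat} := [fset k in iota 0 n].

Lemma mem_fset_iota (n i : nat) : (i \in fset_iota n) = (i < n)%N.
Proof.
by rewrite /fset_iota in_fset -[in_mem _ _]/(i \in iota 0 n) mem_iota.
Qed.

Lemma sum_fset_iota (K : nmodType) (n : nat) (f : nat -> K) :
  \sum_(i <- fset_iota n) f i = \sum_(i < n) f i.
Proof.
rewrite -(big_mkord xpredT f) /index_iota subn0; apply: perm_big.
apply: uniq_perm; rewrite ?iota_uniq ?fset_uniq// => i.
by rewrite mem_fset_iota mem_iota.
Qed.

Lemma fset_iota_cofinal (A : {fset nat}) :
  exists N, forall M, (N <= M)%N -> A `<=` fset_iota M.
Proof.
exists (\max_(i <- A) i)%N.+1 => M AM; apply/fsubsetP => i iA.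
rewrite mem_fset_iota; apply: leq_trans AM.
by rewrite ltnS (big_fsetD1 i iA) /= leq_maxl.
Qed.

(** Summation by fibres.  Given a finite set B of values, choose for every j in B a
finite set on which the fibre sum is known up to e / (2 (|B| + 1)); the union of
these sets controls both the total sum and the sum of the fibre sums over B.  A
fibre is described by a family vanishing off it, so that no subtype is needed. *)
Lemma has_sum_fiber (I J : choiceType) (p : I -> J) (f : I -> C) (g : J -> C)
    (s : C) :
  has_sum f s ->
  (forall j, has_sum (fun i => if p i == j then f i else 0) (g j)) ->
  has_sum g s.
Proof.
move=> fs fg e e0; have e2 : 0 < e / 2 by rewrite divr_gt0.
have [A0 hA0] := fs _ e2.
exists (p @` A0) => B AB.
pose d := e / 2 / (size B).+1%:R.
have d0 : 0 < d by rewrite divr_gt0.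
have [A hA] := choice (fun j => fg j d d0).
(* Elements of A0 lie over B, so restricting to B loses none of them. *)
pose D' := A0 `|` \bigcup_(j <- B) A j.
pose D := [fset i in D' | p i \in B].
have A0D : A0 `<=` D.
  apply/fsubsetP => i iA; rewrite !inE /= iA /=.
  by apply: (fsubsetP AB); apply/imfsetP; exists i.
have sumD : \sum_(i <- D) f i
    = \sum_(j <- B) \sum_(i <- D') (if p i == j then f i else 0).
  rewrite exchange_big /= (eq_bigr _ (fun i _ => sum_fset_eq B (p i) (f i))).
  by rewrite -big_mkcond /= /D big_fset.
rewrite -[s - _](subrKA (\sum_(i <- D) f i)).
rewrite (le_lt_trans (ler_normD _ _))// [ltRHS]splitr ltrD ?hA0//.
rewrite sumD -sumrB (le_lt_trans (ler_norm_sum _ _ _))//.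
apply: (@le_lt_trans _ _ (\sum_(j <- B) d)).
  rewrite big_seq [leRHS]big_seq; apply: ler_sum => j jB.
  rewrite distrC; apply/ltW/hA.
  apply: fsubset_trans (fsubsetUr _ _).
  exact: bigfcup_sup.
rewrite big_const_seq count_predT iter_addr_0 /d -[ltLHS]mulr_natr.
by rewrite mulrAC ltr_pdivrMr// ltr_pM2l// ltr_nat.
Qed.

Lemma abs_summable_le (I : choiceType) (f g : I -> C) :
  (forall i, `|f i| <= `|g i|) -> abs_summable g -> abs_summable f.
Proof.
by move=> fg [M gM]; exists M => A; apply: le_trans (gM A); apply: ler_sum.
Qed.

Lemma abs_summableD (I : choiceType) (f g : I -> C) :
  abs_summable f -> abs_summable g -> abs_summable (fun i => f i + g i).
Proof.
move=> [M fM] [N gN]; exists (M + N) => A; apply: le_trans (lerD (fM A) (gN A)).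
by rewrite -big_split; apply: ler_sum => i _; apply: ler_normD.
Qed.

Lemma abs_summableZ (I : choiceType) (f : I -> C) (c : C) :
  abs_summable f -> abs_summable (fun i => c * f i).
Proof.
move=> [M fM]; exists (`|c| * M) => A; apply: le_trans (ler_wpM2l _ (fM A)) => //.
by rewrite mulr_sumr; apply: ler_sum => i _; rewrite normrM.
Qed.

Lemma abs_summable0 (I : choiceType) : abs_summable (fun _ : I => 0 : C).
Proof. by exists 0 => A; rewrite big1// => i; rewrite normr0. Qed.

Lemma abs_summable_sum (I : choiceType) (K : Type) (r : seq K) (P : pred K)
    (f : K -> I -> C) :
  (forall k, P k -> abs_summable (f k)) ->
  abs_summable (fun i => \sum_(k <- r | P k) f k i).
Proof.
move=> fs; elim: r => [|k r IH].
  under eq_fun do rewrite big_nil.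
  exact: abs_summable0.
case Pk: (P k); last first.
  by rewrite (_ : (fun i => _) = (fun i => \sum_(k <- r | P k) f k i))//;
     apply/funext => i; rewrite big_cons Pk.
rewrite (_ : (fun i => _) = (fun i => f k i + \sum_(k <- r | P k) f k i)); last first.
  by apply/funext => i; rewrite big_cons Pk.
by apply: abs_summableD => //; exact: fs.
Qed.

Lemma abs_summable_inj (I J : choiceType) (h : J -> I) (f : I -> C) :
  injective h -> abs_summable f -> abs_summable (f \o h).
Proof.
move=> hI [M fM]; exists M => A; apply: le_trans (fM (h @` A)).
by rewrite big_imfset //= => x y _ _; exact: hI.
Qed.

Lemma abs_summable_mul (I J : choiceType) (f : I -> C) (g : J -> C) :
  abs_summable f -> abs_summable g ->
  abs_summable (fun ij : I * J => f ij.1 * g ij.2).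
Proof.
move=> [M fM] [N gN]; exists (M * N) => A.
pose A1 := [fset x.1 | x in A]; pose A2 := [fset x.2 | x in A].
have sA : A `<=` A1 `*` A2.
  apply/fsubsetP => x xA; rewrite in_fsetM.
  by apply/andP; split; apply/imfsetP; exists x.
apply: (le_trans (ler_sum_fset sA _)) => //.
have -> : \sum_(x <- A1 `*` A2) `|f x.1 * g x.2|
    = (\sum_(i <- A1) `|f i|) * (\sum_(j <- A2) `|g j|).
  rewrite big_distrlr pair_big_dep_cond /=.
  apply: eq_fbig => [[x y]|[x y] _] /=; last by rewrite normrM.
  rewrite in_fsetM; apply/andP/imfset2P => [[xA yA]|[i + [j + [-> ->]]]].
    by exists x; rewrite ?inE ?xA//; exists y; rewrite ?inE ?yA.
  by rewrite !inE /= !andbT.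
by rewrite ler_pM ?sumr_ge0.
Qed.

(** The fibres of an injection have at most one point. *)
Lemma has_sum_inj (I J : choiceType) (h : J -> I) (f : I -> C) (s : C) :
  injective h -> (forall i, (forall j, i <> h j) -> f i = 0) ->
  has_sum (f \o h) s -> has_sum f s.
Proof.
move=> hI f0 fs; apply: (has_sum_fiber (p := h) fs) => i.
have [[j ->]|ni] := pselect (exists j, i = h j).
  have -> : f (h j) = \sum_(k <- [fset j]) (if h k == h j then (f \o h) k else 0).
    by rewrite big_seq_fset1 eqxx.
  apply: has_sum_finite => k; rewrite inE => kj.
  by case: eqP => // /hI kjE; rewrite kjE eqxx in kj.
rewrite f0; last by move=> j ij; apply: ni; exists j.
have := @has_sum_finite J (fun k => if h k == i then (f \o h) k else 0) fset0.
rewrite big_seq_fset0; apply => k _; case: eqP => // hk.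
by case: ni; exists k.
Qed.

Lemma tsum_inj (I J : choiceType) (h : J -> I) (f : I -> C) :
  injective h -> (forall i, (forall j, i <> h j) -> f i = 0) ->
  abs_summable f -> tsum (f \o h) = tsum f.
Proof.
move=> hI f0 fs; apply/esym/has_sum_tsum/(has_sum_inj hI f0).
exact/abs_summable_has_sum/abs_summable_inj.
Qed.

Lemma tsumD (I : choiceType) (f g : I -> C) :
  abs_summable f -> abs_summable g ->
  tsum (fun i => f i + g i) = tsum f + tsum g.
Proof.
by move=> fs gs; apply/has_sum_tsum/has_sumD; exact: abs_summable_has_sum.
Qed.

Lemma tsumZ (I : choiceType) (f : I -> C) (c : C) :
  abs_summable f -> tsum (fun i => c * f i) = c * tsum f.
Proof.
by move=> fs; apply/has_sum_tsum/has_sumZ; exact: abs_summable_has_sum.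
Qed.

Lemma tsum0 (I : choiceType) : tsum (fun _ : I => 0 : C) = 0.
Proof.
have h := has_sum_tsum (@has_sum_finite I (fun=> 0) fset0 (fun _ _ => erefl)).
by rewrite h big_seq_fset0.
Qed.

Lemma tsum_sum (I : choiceType) (K : Type) (r : seq K) (P : pred K)
    (f : K -> I -> C) :
  (forall k, P k -> abs_summable (f k)) ->
  tsum (fun i => \sum_(k <- r | P k) f k i) = \sum_(k <- r | P k) tsum (f k).
Proof.
move=> fs; elim: r => [|k r IH].
  under eq_fun do rewrite big_nil.
  by rewrite big_nil tsum0.
rewrite big_cons; case Pk: (P k); last first.
  by rewrite -IH; congr tsum; apply/funext => i; rewrite big_cons Pk.
rewrite (_ : (fun i => _) = (fun i => f k i + \sum_(k <- r | P k) f k i)); last first.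
  by apply/funext => i; rewrite big_cons Pk.
by rewrite tsumD ?IH //; [exact: fs|exact: abs_summable_sum].
Qed.

Lemma tsum_pair (I J : choiceType) (f : I * J -> C) :
  abs_summable f -> has_sum (fun i => tsum (fun j => f (i, j))) (tsum f).
Proof.
move=> fs; apply: (has_sum_fiber (p := fst) (abs_summable_has_sum fs)) => i.
apply: (has_sum_inj (h := pair i)).
- by move=> j k [].
- by move=> [i' j] /= ni; case: eqP => // ii; case: (ni j); rewrite ii.
- apply: eq_has_sum (abs_summable_has_sum (_ : abs_summable (f \o pair i))).
    by move=> j /=; rewrite eqxx.
  by apply: abs_summable_inj => // j k [].
Qed.

Lemma tsum_mul (I J : choiceType) (f : I -> C) (g : J -> C) :
  abs_summable f -> abs_summable g ->
  tsum (fun ij : I * J => f ij.1 * g ij.2) = tsum f * tsum g.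
Proof.
move=> fs gs; rewrite -(has_sum_tsum (tsum_pair (abs_summable_mul fs gs))).
apply: has_sum_tsum; rewrite mulrC.
apply: eq_has_sum (has_sumZ (tsum g) (abs_summable_has_sum fs)) => i.
by rewrite /= (tsumZ (f i) gs) mulrC.
Qed.

Lemma tsum_finite_nat (n : nat) (f : nat -> C) :
  (forall i, (n <= i)%N -> f i = 0) -> tsum f = \sum_(i < n) f i.
Proof.
move=> f0.
rewrite -sum_fset_iota; apply/has_sum_tsum/has_sum_finite => i.
by rewrite mem_fset_iota -leqNgt; exact: f0.
Qed.

End Summation.

(** * Lambert series *)

Section LambertSeries.
Variable R : realType.
Local Notation C := R[i].

Lemma has_sum_fiber_finite (I J : choiceType) (p : I -> J) (A : J -> {fset I})
    (f : I -> C) :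
  (forall i, i \in A (p i)) -> abs_summable f ->
  has_sum (fun j => \sum_(i <- A j | p i == j) f i) (tsum f).
Proof.
move=> Ap fs; apply: (has_sum_fiber (p := p) (abs_summable_has_sum fs)) => j.
rewrite big_mkcond; apply: has_sum_finite => i iA.
by case: eqP => // pij; rewrite -pij Ap in iA.
Qed.

Lemma tsum_image (I J : choiceType) (h : J -> I) (P : pred I) (f : I -> C) :
  injective h -> (forall j, P (h j)) -> (forall i, P i -> exists j, i = h j) ->
  abs_summable f ->
  tsum (f \o h) = tsum (fun i => if P i then f i else 0).
Proof.
move=> hI hP Ph fs; have -> : f \o h = (fun i => if P i then f i else 0) \o h.
  by apply/funext => j; rewrite /= hP.
apply: tsum_inj => // [i ni|].
  by case: ifP => // /Ph[j ij]; case: (ni j).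
apply: abs_summable_le fs => i.
by case: ifP => // _; rewrite normr0.
Qed.

(** In the parts x > y and x < y the larger index is parametrised by the difference
minus one, so that the new index runs over all natural numbers again. *)
Lemma tsum_trichotomy (K : choiceType) (f : K * (nat * nat) -> C) :
  abs_summable f ->
  tsum f = tsum (fun p => f (p.1, ((p.2.1 + p.2.2).+1, p.2.2)%N))
         + tsum (fun p : K * nat => f (p.1, (p.2, p.2)))
         + tsum (fun p => f (p.1, (p.2.1, (p.2.1 + p.2.2).+1)%N)).
Proof.
move=> fs.
have ifs (P : pred (K * (nat * nat))) : abs_summable (fun p => if P p then f p else 0).
  by apply: abs_summable_le fs => p; case: ifP => // _; rewrite normr0.
have i1 := ifs (fun p => (p.2.2 < p.2.1)%N).
have i2 := ifs (fun p => (p.2.1 == p.2.2)%N).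
have i3 := ifs (fun p => (p.2.1 < p.2.2)%N).
transitivity (tsum (fun p => (if (p.2.2 < p.2.1)%N then f p else 0)
   + (if (p.2.1 == p.2.2)%N then f p else 0)
   + (if (p.2.1 < p.2.2)%N then f p else 0))).
  by congr tsum; apply/funext => -[k [x y]] /=; case: ltngtP; rewrite ?addr0 ?add0r.
rewrite (tsumD (abs_summableD i1 i2) i3) (tsumD i1 i2).
have add_inj (x x' y : nat) : (x + y = x' + y)%N -> x = x' by lia.
have subK (x y : nat) : (y < x)%N -> x = ((x - y).-1 + y).+1 by lia.
congr (_ + _ + _); symmetry.
- apply: (tsum_image (h := fun p => (p.1, ((p.2.1 + p.2.2).+1, p.2.2)%N))) => //.
  + by move=> [k [x y]] [k' [x' y']] /= [-> + ey]; rewrite ey => /add_inj ->.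
  + by move=> [k [x y]] /=; rewrite ltnS leq_addl.
  + move=> [k [x y]] /= yx; exists (k, ((x - y).-1, y)) => /=.
    by rewrite -(subK _ _ yx).
- apply: (tsum_image (h := fun p : K * nat => (p.1, (p.2, p.2)))) => //.
  + by move=> [k x] [k' x'] /= [-> ->].
  + by move=> [k [x y]] /= /eqP ->; exists (k, y).
- apply: (tsum_image (h := fun p => (p.1, (p.2.1, (p.2.1 + p.2.2).+1)%N))) => //.
  + move=> [k [x y]] [k' [x' y']] /= [-> ex]; rewrite ex.
    by rewrite addnC [in RHS]addnC => /add_inj ->.
  + by move=> [k [x y]] /=; rewrite ltnS leq_addr.
  + move=> [k [x y]] /= yx; exists (k, (x, (y - x).-1)) => /=.
    by rewrite addnC -(subK _ _ yx).
Qed.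

Lemma abs_summable_nat (f : nat -> C) (M : C) :
  (forall n, \sum_(i < n) `|f i| <= M) -> abs_summable f.
Proof.
move=> fM; exists M => A; have [N AN] := fset_iota_cofinal A.
apply: le_trans (ler_sum_fset (AN N (leqnn N)) _) _ => //.
by rewrite (sum_fset_iota N (fun i => `|f i|)).
Qed.

Lemma tsum_shift (i : nat) (f : nat -> C) :
  (forall n, (n < i)%N -> f n = 0) -> abs_summable f ->
  tsum (fun n => f (n + i)%N) = tsum f.
Proof.
move=> f0 fs; apply: (tsum_inj (h := addn^~ i)) => // [|n ni].
  exact: addIn.
by apply: f0; rewrite ltnNge; apply/negP => /subnK/esym; exact: ni.
Qed.

(** Multiplication by 1 - x lowers r by one, by Pascal's rule, up to a last term of
favourable sign. *)
Lemma sum_binomial_le (x : C) (r n : nat) : 0 <= x -> x < 1 ->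
  \sum_(k < n) 'C(k + r, r)%:R * x ^+ k <= (1 - x) ^- r.+1.
Proof.
move=> x0 x1; have y0 : 0 < 1 - x by rewrite subr_gt0.
elim: r n => [|r IH] n.
  rewrite expr1 -(ler_pM2l y0) divff ?gt_eqF//.
  have -> : (1 - x) * (\sum_(k < n) 'C(k + 0, 0)%:R * x ^+ k) = 1 - x ^+ n.
    elim: n => [|n IH]; first by rewrite big_ord0 mulr0 expr0 subrr.
    by rewrite big_ord_recr /= mulrDr IH bin0 exprS; ring.
  by rewrite gerBl exprn_ge0.
rewrite -(ler_pM2l y0) [(1 - x) ^+ r.+2]exprS invfM mulrA divff ?gt_eqF// mul1r.
apply: le_trans (IH n).
have -> : (1 - x) * (\sum_(k < n) 'C(k + r.+1, r.+1)%:R * x ^+ k)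
    = \sum_(k < n) 'C(k + r, r)%:R * x ^+ k - 'C(n + r, r.+1)%:R * x ^+ n.
  elim: n => [|n IHn].
    by rewrite !big_ord0 bin_small// mulr0 mul0r subrr.
  rewrite !big_ord_recr /= mulrDr IHn addnS binS natrD exprS.
  by ring.
by rewrite gerBl mulr_ge0// exprn_ge0.
Qed.

Variable q : C.
Hypothesis q1 : `|q| < 1.

Lemma abs_summable_binomial (r : nat) :
  abs_summable (fun n => 'C(n + r, r)%:R * q ^+ n).
Proof.
apply: (@abs_summable_nat _ ((1 - `|q|) ^- r.+1)) => n.
apply: le_trans (sum_binomial_le r n (normr_ge0 q) q1).
by apply: ler_sum => i _; rewrite normrM normrX normr_nat.
Qed.

(** The recursion on r is again multiplication by 1 - q and Pascal's rule. *)
Lemma tsum_binomial (r : nat) :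
  tsum (fun n => 'C(n + r, r)%:R * q ^+ n) = (1 - q) ^- r.+1.
Proof.
have q0 : 1 - q != 0.
  by rewrite subr_eq0; apply/eqP => e; move: q1; rewrite -e normr1 ltxx.
elim: r => [|r IH].
  apply: (mulfI q0); rewrite divff// mulrBl mul1r -tsumZ; last first.
    exact: abs_summable_binomial.
  pose h n : C := if n is n'.+1 then q ^+ n'.+1 else 0.
  have hs : abs_summable h.
    apply: abs_summable_le (abs_summable_binomial 0) => -[|n] /=.
      by rewrite normr0.
    by rewrite bin0 mul1r.
  have -> : (fun n => q * ('C(n + 0, 0)%:R * q ^+ n)) = (fun n => h (n + 1)%N).
    by apply/funext => n; rewrite bin0 mul1r addn1 /= exprS.
  rewrite tsum_shift//; last by case.
  pose d (n : nat) : C := (n == 0%N)%:R.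
  have ds : abs_summable d.
    apply: abs_summable_le (abs_summable_binomial 0) => -[|n] /=; rewrite /d.
      by rewrite bin0 mul1r.
    by rewrite normr0 normr_ge0.
  have -> : (fun n => 'C(n + 0, 0)%:R * q ^+ n) = (fun n => d n + h n).
    by apply/funext => -[|n] /=; rewrite bin0 mul1r /d /= ?addr0 ?add0r.
  rewrite tsumD// addrK (@tsum_finite_nat _ 1) ?big_ord1//.
  by case.
pose h n : C := 'C(n + r, r.+1)%:R * q ^+ n.
have hs : abs_summable h.
  apply: abs_summable_le (abs_summable_binomial r.+1) => n.
  rewrite !normrM ler_wpM2r// !normr_nat ler_nat addnS binS.
  exact: leq_addr.
apply: (mulfI q0); rewrite exprS invfM mulrA divff// mul1r -IH.
rewrite mulrBl mul1r -tsumZ; last exact: abs_summable_binomial.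
have -> : (fun n => q * ('C(n + r.+1, r.+1)%:R * q ^+ n)) = (fun n => h (n + 1)%N).
  by apply/funext => n; rewrite /h -addnA add1n addn1 exprS; ring.
rewrite tsum_shift//; last by case=> // _; rewrite /h bin_small// mul0r.
have -> : (fun n => 'C(n + r.+1, r.+1)%:R * q ^+ n)
    = (fun n => 'C(n + r, r)%:R * q ^+ n + h n).
  by apply/funext => n; rewrite /h addnS binS natrD; ring.
by rewrite tsumD ?addrK//; exact: abs_summable_binomial.
Qed.

(** Comparison with the binomial series, since (n + 1)^r <= r! C(n + r, r). *)
Lemma abs_summable_power (r : nat) :
  abs_summable (fun n => n.+1%:R ^+ r * q ^+ n).
Proof.
apply: abs_summable_le (abs_summableZ (r`!)%:R (abs_summable_binomial r)) => n.
rewrite mulrA !normrM ler_wpM2r// -normrM -natrX -natrM !normr_nat ler_nat.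
rewrite mulnC bin_ffact; elim: r => [|r IH]; first by rewrite ffactn0.
rewrite addnS ffactSS expnS leq_mul// ltnS leq_addr//.
Qed.

Lemma norm_q_exp_le (a x : nat) : `|q ^+ (a.+1 * x.+1)| <= `|q ^+ a * q ^+ x|.
Proof.
rewrite -exprD !normrX; apply: ler_wiXn2l; rewrite ?normr_ge0 ?(ltW q1)//.
by rewrite mulSn mulnS; lia.
Qed.

(** The pair (a, x) of natural numbers stands for the positive integers a + 1 and
x + 1; all index sets of Lambert series below are shifted in this way. *)
Definition lambert_term (f : nat -> C) (p : nat * nat) : C :=
  f p.1.+1 * q ^+ (p.1.+1 * p.2.+1).

Definition lambert (f : nat -> C) : C := tsum (lambert_term f).

Lemma abs_summable_lambert_power (r : nat) :
  abs_summable (lambert_term (fun n => n%:R ^+ r)).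
Proof.
have h := abs_summable_mul (abs_summable_power r) (abs_summable_power 0).
apply: abs_summable_le h => -[a x] /=.
by rewrite expr0 mul1r -mulrA normrM [leRHS]normrM ler_wpM2l// norm_q_exp_le.
Qed.

Lemma lambert_term_odd_poly (r : {poly C}) (p : nat * nat) :
  lambert_term (fun n => n%:R * r.[n%:R ^+ 2]) p =
  \sum_(j < size r) r`_j * lambert_term (fun n => n%:R ^+ j.*2.+1) p.
Proof.
case: p => a x; rewrite /lambert_term /= horner_coef mulr_sumr mulr_suml.
apply: eq_bigr => j _.
by rewrite [RHS]mulrA; congr (_ * _); rewrite mulrCA -exprM mul2n -exprS.
Qed.

Lemma abs_summable_lambert_odd_poly (r : {poly C}) :
  abs_summable (lambert_term (fun n => n%:R * r.[n%:R ^+ 2])).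
Proof.
rewrite (funext (lambert_term_odd_poly r)); apply: abs_summable_sum => j _.
exact/abs_summableZ/abs_summable_lambert_power.
Qed.

Lemma lambert_odd_poly (r : {poly C}) :
  lambert (fun n => n%:R * r.[n%:R ^+ 2]) =
  \sum_(j < size r) r`_j * lambert (fun n => n%:R ^+ j.*2.+1).
Proof.
have ps k := abs_summable_lambert_power k.
rewrite /lambert (funext (lambert_term_odd_poly r)) tsum_sum; last first.
  by move=> j _; exact: abs_summableZ (ps _).
by apply: eq_bigr => j _; rewrite tsumZ.
Qed.

Lemma sum_divisors (K : nmodType) (n : nat) (f : nat -> K) :
  \sum_(d <- divisors n.+1) f d
  = \sum_(a < n.+1) (if (a.+1 %| n.+1)%N then f a.+1 else 0).
Proof.
rewrite -(big_mkord xpredT (fun a => if (a.+1 %| n.+1)%N then f a.+1 else 0)).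
rewrite -big_mkcond -(big_add1 _ _ 0 n.+2 (dvdn^~ n.+1)) -big_filter.
apply: perm_big; apply: uniq_perm.
- exact: divisors_uniq.
- exact/filter_uniq/iota_uniq.
- move=> d; rewrite -dvdn_divisors// mem_filter mem_index_iota.
  case: (boolP (d %| n.+1)%N) => // dn.
  by rewrite ltnS (dvdn_leq _ dn)// (dvdn_gt0 (ltn0Sn n) dn).
Qed.

(** The fibre of (a, x) -> a x over n is indexed by the divisors a of n. *)
Lemma lambert_divisor_sigma (r : nat) :
  has_sum (fun n => (divisor_sigma r n.+1)%:R * q ^+ n.+1)
    (lambert (fun n => n%:R ^+ r)).
Proof.
pose A n := [fset (a, (n.+1 %/ a.+1).-1) | a in fset_iota n.+1].
pose p (ax : nat * nat) := (ax.1.+1 * ax.2.+1).-1.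
have pA ax : ax \in A (p ax).
  case: ax => a x; apply/imfsetP; exists a.
    by rewrite [_ \in _]mem_fset_iota /p prednK ?muln_gt0// leq_pmulr.
  by congr pair; rewrite /p prednK// mulKn.
have pE a x n : (p (a, x) == n) = (a.+1 * x.+1 == n.+1)%N.
  by rewrite /p -eqSS prednK ?muln_gt0.
apply: eq_has_sum (has_sum_fiber_finite pA (abs_summable_lambert_power r)) => n.
rewrite /A big_mkcond big_imfset; last by move=> a b _ _ [].
rewrite [LHS](sum_fset_iota n.+1 (fun a => if p (a, (n.+1 %/ a.+1).-1) == n
  then lambert_term (fun m => m%:R ^+ r) (a, (n.+1 %/ a.+1).-1) else 0)).
rewrite /divisor_sigma natr_sum mulr_suml sum_divisors.
apply: eq_bigr => -[a an] _; rewrite -[nat_of_ord _]/a pE.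
have d0 : (0 < n.+1 %/ a.+1)%N by rewrite divn_gt0.
rewrite prednK// mulnC -dvdn_eq; case: ifP => // /divnK e.
by rewrite /lambert_term -[(_, _).1]/a -[(_, _).2]/(_.-1) prednK// mulnC e natrX.
Qed.

End LambertSeries.

(** * Double Lambert series and the exchange of variables *)

Section DoubleSeries.
Variable R : realType.
Local Notation C := R[i].

Lemma tsum_bij (I J : choiceType) (h : J -> I) (g : I -> J) (f : I -> C) :
  cancel h g -> cancel g h -> abs_summable f -> tsum (f \o h) = tsum f.
Proof.
move=> hK gK; apply: tsum_inj; first exact: can_inj hK.
by move=> i ni; case: (ni (g i)); rewrite gK.
Qed.

Variable q : C.

Definition double_term (F : nat -> nat -> C)
    (p : (nat * nat) * (nat * nat)) : C :=
  F p.1.1.+1 p.1.2.+1 * q ^+ (p.1.1.+1 * p.2.1.+1 + p.1.2.+1 * p.2.2.+1).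

Definition double_lambert (F : nat -> nat -> C) : C := tsum (double_term F).

Lemma double_term_mul (f g : nat -> C) (p : (nat * nat) * (nat * nat)) :
  double_term (fun a b => f a * g b) p =
  lambert_term q f (p.1.1, p.2.1) * lambert_term q g (p.1.2, p.2.2).
Proof. by rewrite /double_term /lambert_term exprD mulrACA. Qed.

Lemma abs_summable_double_mul (f g : nat -> C) :
  abs_summable (lambert_term q f) -> abs_summable (lambert_term q g) ->
  abs_summable (double_term (fun a b => f a * g b)).
Proof.
move=> fs gs; rewrite (funext (double_term_mul f g)).
pose h (p : (nat * nat) * (nat * nat)) := ((p.1.1, p.2.1), (p.1.2, p.2.2)).
apply: (abs_summable_inj (h := h)) (abs_summable_mul fs gs).
by move=> [[a b] [x y]] [[a' b'] [x' y']] [-> -> -> ->].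
Qed.

Lemma double_lambert_mul (f g : nat -> C) :
  abs_summable (lambert_term q f) -> abs_summable (lambert_term q g) ->
  double_lambert (fun a b => f a * g b) = lambert q f * lambert q g.
Proof.
move=> fs gs; rewrite /double_lambert (funext (double_term_mul f g)).
rewrite -(tsum_mul fs gs).
pose h (p : (nat * nat) * (nat * nat)) := ((p.1.1, p.2.1), (p.1.2, p.2.2)).
by apply: (tsum_bij (h := h) (g := h)) (abs_summable_mul fs gs) => -[[a b] [x y]].
Qed.

(** Sum over the triples (a, b, x) along the fibres of (a + b, x); the boundary
terms a = 0 and b = 0 of the inner sum vanish by hypothesis. *)
Lemma lambert_convolution (F : nat -> nat -> C) :
  (forall a b, F a b = F b a) -> (forall a, F a 0%N = 0) ->
  abs_summable (fun p : (nat * nat) * nat => F p.1.1.+1 p.1.2.+1 *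
    q ^+ ((p.1.1.+1 + p.1.2.+1) * p.2.+1)) ->
  lambert q (fun n => \sum_(a < n.+1) F a (n - a)%N) =
  tsum (fun p : (nat * nat) * nat => F p.1.1.+1 p.1.2.+1 *
    q ^+ ((p.1.1.+1 + p.1.2.+1) * p.2.+1)).
Proof.
move=> Fsym F0 Vs.
pose A (dx : nat * nat) :=
  [fset ((a, (dx.1 - a).-1), dx.2) | a in fset_iota dx.1].
pose p (abx : (nat * nat) * nat) := ((abx.1.1 + abx.1.2).+1, abx.2).
have pA abx : abx \in A (p abx).
  case: abx => [[a b] x]; apply/imfsetP; exists a.
    by rewrite [_ \in _]mem_fset_iota /= ltnS leq_addr.
  by rewrite /= subSn ?leq_addr// addKn.
apply: has_sum_tsum; apply: eq_has_sum (has_sum_fiber_finite pA Vs) => -[d x].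
rewrite /A big_mkcond big_imfset; last by move=> a b _ _ [].
rewrite [LHS](sum_fset_iota d (fun a =>
  if p ((a, (d - a).-1), x) == (d, x)
  then F a.+1 (d - a).-1.+1 * q ^+ ((a.+1 + (d - a).-1.+1) * x.+1) else 0)).
rewrite /lambert_term /= big_ord_recl Fsym F0 add0r mulr_suml.
rewrite big_ord_recr /= /bump /= subnn F0 mul0r addr0.
apply: eq_bigr => -[a /= ad] _; rewrite /p /=.
have e : (d - a).-1.+1 = (d - a)%N by rewrite prednK// subn_gt0.
have e1 : (a + (d - a).-1).+1 = d by lia.
by rewrite e e1 eqxx add1n subSS; congr (_ * q ^+ _); lia.
Qed.

(** With U = sum F(a, b) q^(a x + (a + b) y) and V = sum F(a, b) q^((a + b) x), the
parts x > y, x = y and x < y of the series of F are U, V and U, while the parts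
a < b, a = b and a > b of the series of G are U, 0 and U. *)
Lemma double_lambert_exchange (F G : nat -> nat -> C) :
  (forall a b, F a b = F b a) -> (forall a b, G a b = G b a) ->
  (forall a b, G a (a + b)%N = F a b) -> (forall a, G a a = 0) ->
  abs_summable (double_term F) -> abs_summable (double_term G) ->
  double_lambert F = double_lambert G +
    lambert q (fun n => \sum_(a < n.+1) F a (n - a)%N).
Proof.
move=> Fsym Gsym GF G0 Fs Gs.
pose U := tsum (fun p : (nat * nat) * (nat * nat) => F p.1.1.+1 p.1.2.+1 *
  q ^+ (p.1.1.+1 * p.2.1.+1 + (p.1.1.+1 + p.1.2.+1) * p.2.2.+1)).
pose V := tsum (fun p : (nat * nat) * nat => F p.1.1.+1 p.1.2.+1 *
  q ^+ ((p.1.1.+1 + p.1.2.+1) * p.2.+1)).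
have inj1 : injective (fun p : (nat * nat) * (nat * nat) =>
  (p.1, ((p.2.1 + p.2.2).+1, p.2.2)%N)).
  move=> [ab [x y]] [ab' [x' y']] /= [-> + ey]; rewrite ey => /eqP.
  by rewrite eqn_add2r => /eqP ->.
have Us : abs_summable (fun p : (nat * nat) * (nat * nat) => F p.1.1.+1 p.1.2.+1 *
  q ^+ (p.1.1.+1 * p.2.1.+1 + (p.1.1.+1 + p.1.2.+1) * p.2.2.+1)).
  apply: abs_summable_le (abs_summable_inj inj1 Fs) => -[[a b] [x y]].
  rewrite le_eqVlt; apply/orP; left; apply/eqP; congr `|_ * q ^+ _|.
  by rewrite /=; lia.
have swapK : involutive (fun p : (nat * nat) * (nat * nat) =>
    ((p.1.2, p.1.1), (p.2.2, p.2.1))) by move=> [[a b] [x y]].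
have swap2K : involutive (fun p : (nat * nat) * (nat * nat) => (p.2, p.1)).
  by move=> [[a b] [x y]].
have FE : double_lambert F = U + V + U.
  rewrite /double_lambert (tsum_trichotomy Fs).
  refine (f_equal2 +%R (f_equal2 +%R _ _) _).
  - congr tsum; apply/funext => -[[a b] [x y]].
    by congr (_ * q ^+ _); rewrite /=; lia.
  - congr tsum; apply/funext => -[[a b] x].
    by congr (_ * q ^+ _); rewrite /=; lia.
  - rewrite -[RHS](tsum_bij swapK swapK Us).
    congr tsum; apply/funext => -[[a b] [x y]].
    by rewrite /double_term /= Fsym; congr (_ * q ^+ _); lia.
have GE : double_lambert G = U + U.
  rewrite /double_lambert -(tsum_bij swap2K swap2K Gs).
  rewrite tsum_trichotomy; last first.
    by apply: abs_summable_inj Gs; exact: can_inj swap2K.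
  rewrite [X in _ + X + _](_ : _ = 0); last first.
    by rewrite -[RHS](tsum0 _ (nat * nat * nat)%type); congr tsum;
      apply/funext => -[[a b] x]; rewrite /double_term /= G0 mul0r.
  rewrite addr0; refine (f_equal2 +%R _ _).
  - rewrite -[RHS](tsum_bij swapK swapK Us) -[RHS](tsum_bij swap2K swap2K) /=; last first.
      by apply: abs_summable_inj Us; exact: can_inj swapK.
    congr tsum; apply/funext => -[[x y] [a b]].
    rewrite /double_term /= (_ : (a + b).+2 = b.+1 + a.+1)%N; last by lia.
    by rewrite Gsym GF; congr (_ * q ^+ _); lia.
  - rewrite -[RHS](tsum_bij swap2K swap2K Us).
    congr tsum; apply/funext => -[[x y] [a b]].
    rewrite /double_term /= (_ : (a + b).+2 = a.+1 + b.+1)%N; last by lia.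
    by rewrite GF; congr (_ * q ^+ _); lia.
have VE : lambert q (fun n => \sum_(a < n.+1) F a (n - a)%N) = V.
  apply: lambert_convolution => // [a|].
    by rewrite -GF addn0 G0.
  have inj0 : injective (fun p : (nat * nat) * nat => (p.1, (p.2, p.2))).
    by move=> [ab x] [ab' x'] /= [-> ->].
  apply: abs_summable_le (abs_summable_inj inj0 Fs) => -[[a b] x].
  rewrite le_eqVlt; apply/orP; left; apply/eqP; congr `|_ * q ^+ _|.
  by rewrite /=; lia.
by rewrite FE GE VE addrAC.
Qed.

End DoubleSeries.

(** * Centred power sums are odd polynomials *)

Section OddPowerSums.
Variable K : numFieldType.

Lemma sum_double (V : nmodType) (n : nat) (f : nat -> V) :
  \sum_(k < n.*2) f k = \sum_(i < n) (f i.*2 + f i.*2.+1).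
Proof.
elim: n => [|n IH]; first by rewrite !big_ord0.
by rewrite doubleS !big_ord_recr /= IH addrA.
Qed.

Lemma binomial_odd_split (x : K) (r : nat) :
  (1 + x) ^+ r.*2.+1 =
  \sum_(i < r.+1) 'C(r.*2.+1, i.*2)%:R * x ^+ i.*2 +
  \sum_(i < r.+1) 'C(r.*2.+1, i.*2.+1)%:R * x ^+ i.*2.+1.
Proof.
rewrite exprDn -[r.*2.+2]/(r.+1.*2) -big_split /=.
rewrite -(sum_double r.+1 (fun k => 'C(r.*2.+1, k)%:R * x ^+ k)).
by apply: eq_bigr => i _; rewrite expr1n mul1r -mulr_natl.
Qed.

(** The variable a - (n - a) runs over - n, - n + 2, ..., n.  In this symmetric form the
even power sums are odd polynomials in n, up to the boundary term n^(2r) of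
[centered_sum_poly]. *)
Definition centered_sum (r n : nat) : K :=
  \sum_(a < n.+1) (a%:R - (n - a)%:R) ^+ r.*2.

(** The increments (s + 1)^(2r+1) - (s - 1)^(2r+1) at s = - n, - n + 2, ..., n telescope
to 2 (n + 1)^(2r+1). *)
Lemma centered_sum_binomial (r n : nat) :
  \sum_(i < r.+1) 'C(r.*2.+1, i.*2)%:R * centered_sum i n = n.+1%:R ^+ r.*2.+1.
Proof.
pose t (a : nat) : K := a%:R *+ 2 - n.+1%:R.
have step (a : nat) : (a < n.+1)%N ->
    t a.+1 ^+ r.*2.+1 - t a ^+ r.*2.+1 =
    (\sum_(i < r.+1) 'C(r.*2.+1, i.*2)%:R * (a%:R - (n - a)%:R) ^+ i.*2) *+ 2.
  rewrite ltnS => an; set s : K := a%:R - (n - a)%:R.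
  have -> : t a.+1 = 1 + s.
    by rewrite /t /s natrB// -!natr1; ring.
  have -> : t a = - (1 + - s).
    by rewrite /t /s natrB// -!natr1; ring.
  rewrite [(- (1 - s)) ^+ _]exprNn -signr_odd /= odd_double expr1 mulN1r opprK.
  rewrite !binomial_odd_split addrACA -2!big_split /=.
  rewrite [X in _ + X]big1 ?addr0; last first.
    by move=> i _; rewrite [(- s) ^+ _]exprNn -signr_odd /= odd_double; ring.
  rewrite -sumrMnl; apply: eq_bigr => i _.
  by rewrite [(- s) ^+ _]exprNn -signr_odd odd_double; ring.
have : \sum_(a < n.+1) (t a.+1 ^+ r.*2.+1 - t a ^+ r.*2.+1) = n.+1%:R ^+ r.*2.+1 *+ 2.
  rewrite -(big_mkord xpredT (fun a => t a.+1 ^+ r.*2.+1 - t a ^+ r.*2.+1)).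
  rewrite telescope_sumr// /t mul0rn sub0r exprNn -signr_odd /= odd_double.
  have -> : n.+1%:R *+ 2 - n.+1%:R = n.+1%:R :> K by ring.
  by ring.
rewrite (eq_bigr _ (fun (a : 'I_n.+1) _ => step a (ltn_ord a))) sumrMnl => /pmulrnI <- //.
under eq_bigr do rewrite /centered_sum mulr_sumr.
by rewrite exchange_big.
Qed.

(** Compare [centered_sum_binomial] with the expansion of (1 + n)^(2r+1): the even
powers of n there are the boundary terms, and the odd ones give the recursion for v. *)
Lemma centered_sum_poly (r : nat) : exists v : {poly K},
  [/\ (size v <= r.+1)%N, v`_r = r.*2.+1%:R^-1 &
      forall n, centered_sum r n = n%:R ^+ r.*2 + n%:R * v.[n%:R ^+ 2]].
Proof.
elim/ltn_ind: r => r IH.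
have /choice[v hv] : forall i, exists w : {poly K}, (i < r)%N ->
    [/\ (size w <= i.+1)%N, w`_i = i.*2.+1%:R^-1 &
      forall n, centered_sum i n = n%:R ^+ i.*2 + n%:R * w.[n%:R ^+ 2]].
  by move=> i; case: (ltnP i r) => [/IH[w hw]|_]; [exists w|exists 0].
pose u : {poly K} := \poly_(i < r.+1) 'C(r.*2.+1, i.*2.+1)%:R
  - \sum_(i < r) 'C(r.*2.+1, i.*2)%:R *: v i.
have c0 : r.*2.+1%:R != 0 :> K by rewrite pnatr_eq0.
exists (r.*2.+1%:R^-1 *: u); split.
- rewrite size_scale ?invr_eq0// (leq_trans (size_polyD _ _))// geq_max size_poly.
  rewrite size_polyN (leq_trans (size_sum _ _ _))//; apply/bigmax_leqP => i _.
  have [vi _ _] := hv i (ltn_ord i).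
  rewrite (leq_trans (size_scale_leq _ _))// (leq_trans vi)//.
  exact: leqW (ltn_ord i).
- rewrite coefZ coefB coef_poly ltnSn binn coef_sum big1 ?subr0 ?mulr1// => i _.
  have [vi _ _] := hv i (ltn_ord i).
  by rewrite coefZ nth_default ?mulr0// (leq_trans vi).
move=> n; apply: (mulfI c0); rewrite mulrDr hornerZ [_ * (n%:R * _)]mulrCA (mulVKf c0).
have := centered_sum_binomial r n.
rewrite -natr1 [n%:R + 1]addrC binomial_odd_split !big_ord_recr /= binSn.
have -> : \sum_(i < r) 'C(r.*2.+1, i.*2)%:R * centered_sum i n
    = \sum_(i < r) 'C(r.*2.+1, i.*2)%:R * n%:R ^+ i.*2
    + n%:R * \sum_(i < r) 'C(r.*2.+1, i.*2)%:R * (v i).[n%:R ^+ 2].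
  rewrite mulr_sumr -big_split; apply: eq_bigr => i _ /=.
  have [_ _ ->] := hv i (ltn_ord i).
  by ring.
have -> : u.[n%:R ^+ 2] = \sum_(i < r.+1) 'C(r.*2.+1, i.*2.+1)%:R * n%:R ^+ i.*2
    - \sum_(i < r) 'C(r.*2.+1, i.*2)%:R * (v i).[n%:R ^+ 2].
  rewrite hornerD hornerN horner_poly horner_sum; congr (_ - _).
    by apply: eq_bigr => i _; rewrite -exprM mul2n.
  by apply: eq_bigr => i _; rewrite hornerZ.
rewrite mulrBr [n%:R * \sum_(i < r.+1) _]mulr_sumr big_ord_recr /=.
under [\sum_(i < r) n%:R * _]eq_bigr do rewrite mulrCA -exprS.
rewrite [n%:R * (_ * _ ^+ _)]mulrCA -exprS => e; apply: (addrI
  (\sum_(i < r) 'C(r.*2.+1, i.*2)%:R * n%:R ^+ i.*2 +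
   n%:R * \sum_(i < r) 'C(r.*2.+1, i.*2)%:R * (v i).[n%:R ^+ 2])).
by rewrite e; ring.
Qed.

(** The factor n^2 - s^2, where s is the centred variable, vanishes at both ends
s = n and s = - n, which removes the boundary terms of [centered_sum_poly]. *)
Definition weighted_sum (i n : nat) : K :=
  \sum_(a < n.+1) (a%:R - (n - a)%:R) ^+ i.*2 *
    (n%:R ^+ 2 - (a%:R - (n - a)%:R) ^+ 2) ^+ 2.

(** The leading coefficient is the integral of s^(2i) (1 - s^2)^2 over [0, 1], that is
8 / (y (y + 2) (y + 4)) with y = 2i + 1. *)
Lemma weighted_sum_poly (i : nat) : exists w : {poly K},
  [/\ (size w <= i.+3)%N, 0 < w`_i.+2 &
      forall n, weighted_sum i n = n%:R * w.[n%:R ^+ 2]].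
Proof.
have [v0 [s0 l0 e0]] := centered_sum_poly i.
have [v1 [s1 l1 e1]] := centered_sum_poly i.+1.
have [v2 [s2 l2 e2]] := centered_sum_poly i.+2.
exists ((v0 * 'X - 2 *: v1) * 'X + v2); split.
- rewrite (leq_trans (size_polyD _ _))// geq_max s2 andbT.
  rewrite (leq_trans (size_polyMleq _ _))// size_polyX addn2 /= ltnS.
  rewrite (leq_trans (size_polyD _ _))// geq_max size_polyN; apply/andP; split.
    by rewrite (leq_trans (size_polyMleq _ _))// size_polyX addn2.
  exact: leq_trans (size_scale_leq _ _) s1.
- rewrite coefD coefMX /= coefB coefMX coefZ /= l0 l1 l2.
  have h (k : nat) : 0 < k.+1%:R :> K by rewrite ltr0n.
  have -> : i.+1.*2.+1 = (i.*2.+1 + 2)%N by lia.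
  have -> : i.+2.*2.+1 = (i.*2.+1 + 4)%N by lia.
  rewrite !natrD; move: i.*2.+1%:R (h i.*2) => y y0.
  have -> : y^-1 - 2 * (y + 2)^-1 + (y + 4)^-1 = 8 / (y * (y + 2) * (y + 4)).
    by field; rewrite !gt_eqF ?addr_gt0.
  by rewrite divr_gt0// !mulr_gt0 ?addr_gt0.
move=> n; rewrite hornerD hornerMX hornerD hornerN hornerZ hornerMX.
transitivity (n%:R ^+ 4 * centered_sum i n - 2 * n%:R ^+ 2 * centered_sum i.+1 n
  + centered_sum i.+2 n).
  rewrite /weighted_sum /centered_sum !mulr_sumr -sumrB -big_split /=.
  apply: eq_bigr => a _; rewrite !doubleS; move: (_ - _ : K) => s.
  rewrite [s ^+ i.*2.+4]exprS [s ^+ i.*2.+3]exprS.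
  rewrite [s ^+ i.*2.+2]exprS [s ^+ i.*2.+1]exprS.
  by move: (s ^+ i.*2) => t; ring.
rewrite e0 e1 e2 !doubleS.
rewrite [n%:R ^+ i.*2.+4]exprS [n%:R ^+ i.*2.+3]exprS.
rewrite [n%:R ^+ i.*2.+2]exprS [n%:R ^+ i.*2.+1]exprS.
move: (n%:R ^+ i.*2) => t; ring.
Qed.

End OddPowerSums.

(** * A binary form with dihedral symmetry *)

Section DihedralForm.
Variable K : numFieldType.

(** The factors a b (a + b), up to sign, and a^2 + a b + b^2 are the basic invariants of
the dihedral group of order 12 that permutes, up to a common sign, the triple
(a, b, - a - b). *)
Definition dihedral_form (m : nat) (a b : K) : K :=
  a ^+ 2 * b ^+ 2 * (a + b) ^+ 2 * (a ^+ 2 + a * b + b ^+ 2) ^+ m.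

Lemma dihedral_formC (m : nat) (a b : K) : dihedral_form m a b = dihedral_form m b a.
Proof.
rewrite /dihedral_form (_ : b ^+ 2 + b * a + a ^+ 2 = a ^+ 2 + a * b + b ^+ 2).
  by ring.
by ring.
Qed.

Lemma dihedral_formN (m : nat) (a b : K) : dihedral_form m (- a) (- b) = dihedral_form m a b.
Proof.
rewrite /dihedral_form (_ : (- a) ^+ 2 + - a * - b + (- b) ^+ 2 = a ^+ 2 + a * b + b ^+ 2).
  by ring.
by ring.
Qed.

Lemma dihedral_form_shift (m : nat) (a b : K) :
  dihedral_form m a (- (a + b)) = dihedral_form m a b.
Proof.
rewrite /dihedral_form.
rewrite (_ : a ^+ 2 + a * - (a + b) + (- (a + b)) ^+ 2 = a ^+ 2 + a * b + b ^+ 2).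
  by ring.
by ring.
Qed.

Lemma dihedral_form0 (m : nat) (a : K) : dihedral_form m a (- a) = 0.
Proof. by rewrite /dihedral_form subrr expr0n mulr0 mul0r. Qed.

(** Dehomogenise: the form is a^(2m+4) b^2 g(b / a) for the polynomial g below. *)
Lemma dihedral_form_expand (m : nat) : exists c : nat -> K, forall a b : K, a != 0 ->
  dihedral_form m a b = \sum_(i < m.*2.+3) c i * (a ^+ (m.*2.+4 - i) * b ^+ i.+2).
Proof.
pose g : {poly K} := (1 + 'X) ^+ 2 * (1 + 'X + 'X ^+ 2) ^+ m.
have s1 : size (1 + 'X : {poly K}) = 2%N.
  by rewrite addrC -[1]/(1%:P) size_XaddC.
have s2 : (size (1 + 'X + 'X ^+ 2 : {poly K})%R <= 3)%N.
  by rewrite (leq_trans (size_polyD _ _))// geq_max s1 size_polyXn.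
have sg : (size g <= m.*2.+3)%N.
  rewrite (leq_trans (size_polyMleq _ _))//.
  have h1 : (size ((1 + 'X : {poly K}) ^+ 2)%R <= 3)%N.
    by rewrite (leq_trans (size_poly_exp_leq _ _))// s1.
  have h2 : (size ((1 + 'X + 'X ^+ 2 : {poly K}) ^+ m)%R <= m.*2.+1)%N.
    rewrite (leq_trans (size_poly_exp_leq _ _))// ltnS -muln2 mulnC leq_mul2l.
    by apply/orP; right; move: s2; case: (size _).
  lia.
exists (fun i => g`_i) => a b a0.
transitivity (a ^+ m.*2.+4 * b ^+ 2 * g.[b / a]); last first.
  rewrite (horner_coef_wide _ sg) mulr_sumr; apply: eq_bigr => -[i /= im] _.
  have -> : a ^+ m.*2.+4 = a ^+ (m.*2.+4 - i) * a ^+ i.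
    by rewrite -exprD subnK//; lia.
  rewrite expr_div_n -[i.+2]addn2 exprD.
  have ai0 : a ^+ i != 0 by rewrite expf_neq0.
  by field.
rewrite /g hornerM !horner_exp !hornerD hornerC hornerX horner_exp hornerX.
have -> : dihedral_form m a b = a ^+ 4 * b ^+ 2 * (1 + b / a) ^+ 2 *
    (a ^+ 2 * (1 + b / a + (b / a) ^+ 2)) ^+ m.
  rewrite /dihedral_form (_ : a ^+ 2 * (1 + b / a + (b / a) ^+ 2) = a ^+ 2 + a * b + b ^+ 2).
    by field.
  by field.
have -> : a ^+ m.*2.+4 = a ^+ 4 * (a ^+ 2) ^+ m.
  by rewrite -exprM -exprD; congr (_ ^+ _); lia.
rewrite exprMn; move: (_ ^+ m) (_ ^+ m) => s t; ring.
Qed.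

(** The difference keeps the part that is odd in b, hence odd in a since the total
degree is even; as a^2 b^2 divides the form, all exponents are between 3 and 2m + 3. *)
Lemma dihedral_form_diff (m : nat) : exists c : nat -> K, forall a b : K, a != 0 ->
  dihedral_form m a b - dihedral_form m a (- b) =
  \sum_(i < m.*2.+3 | odd i) c i * (a ^+ (m.*2.+4 - i) * b ^+ i.+2).
Proof.
have [c hc] := dihedral_form_expand m.
exists (fun i => 2 * c i) => a b a0; rewrite !hc// -sumrB big_mkcond [RHS]big_mkcond.
rewrite [RHS]big_mkcond /=; apply: eq_bigr => i _.
rewrite [(- b) ^+ _]exprNn -signr_odd /= negbK; case: (odd i); ring.
Qed.

(** With d = a + b and s = a - b,
  4^(m+2) (a b (a + b))^2 (a^2 + a b + b^2)^m = d^2 (d^2 - s^2)^2 (3 d^2 + s^2)^m.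
Expanding the last factor in powers of s gives a combination of the sums of
[weighted_sum_poly] with positive coefficients, so the leading terms cannot cancel. *)
Lemma dihedral_form_sum_poly (m : nat) : exists r : {poly K},
  [/\ size r = m.+4 & forall n : nat,
    \sum_(a < n.+1) dihedral_form m a%:R (n - a)%:R = n%:R * r.[n%:R ^+ 2]].
Proof.
have /choice[w hw] := @weighted_sum_poly K.
pose r : {poly K} := \sum_(i < m.+1) ('C(m, i)%:R * 3 ^+ (m - i)) *: (w i * 'X^((m - i).+1)).
have k0 : (4 ^+ m.+2 : K) != 0 by rewrite expf_neq0.
exists ((4 ^+ m.+2)^-1 *: r); split.
- rewrite size_scale ?invr_eq0//; apply/eqP; rewrite eqn_leq; apply/andP; split.
    rewrite (leq_trans (size_sum _ _ _))//; apply/bigmax_leqP => -[i im] _ /=.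
    have [wi _ _] := hw i.
    rewrite (leq_trans (size_scale_leq _ _))// (leq_trans (size_polyMleq _ _))//.
    by rewrite size_polyXn; lia.
  rewrite ltnNge; apply/negP => /leq_sizeP/(_ _ (leqnn _)) /eqP.
  have pos (i : nat) : (i < m.+1)%N ->
      0 < (('C(m, i)%:R * 3 ^+ (m - i)) *: (w i * 'X^((m - i).+1)))`_m.+3.
    move=> im; have [_ wi _] := hw i.
    rewrite coefZ coefMXn ltnNge (_ : ((m - i).+1 <= m.+3)%N) /=; last by lia.
    rewrite (_ : m.+3 - (m - i).+1 = i.+2)%N; last by lia.
    by rewrite !mulr_gt0// ?exprn_gt0// ltr0n bin_gt0.
  apply/negP; rewrite coef_sum gt_eqF// big_ord_recr /= ltr_wpDl ?pos//.
  by apply: sumr_ge0 => -[i im] _; rewrite ltW// pos// ltnW.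
move=> n; apply: (mulfI k0); rewrite hornerZ [RHS]mulrCA (mulVKf k0).
transitivity (\sum_(i < m.+1) ('C(m, i)%:R * 3 ^+ (m - i)) *
    (n%:R ^+ 2) ^+ (m - i).+1 * weighted_sum K i n).
  under [RHS]eq_bigr do rewrite /weighted_sum mulr_sumr.
  rewrite exchange_big mulr_sumr; apply: eq_bigr => -[a an] _ /=.
  have -> : n%:R = a%:R + (n - a)%:R :> K by rewrite -natrD subnKC.
  move: (a%:R : K) ((n - a)%:R : K) => x y.
  have -> : 4 ^+ m.+2 * dihedral_form m x y = (x + y) ^+ 2 *
      ((x + y) ^+ 2 - (x - y) ^+ 2) ^+ 2 * (3 * (x + y) ^+ 2 + (x - y) ^+ 2) ^+ m.
    rewrite /dihedral_form (_ : 3 * (x + y) ^+ 2 + (x - y) ^+ 2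
      = 4 * (x ^+ 2 + x * y + y ^+ 2)); last by ring.
    rewrite [(4 * _) ^+ m]exprMn [4 ^+ m.+2]exprS [4 ^+ m.+1]exprS.
    by move: (_ ^+ m) (_ ^+ m) => s t; ring.
  rewrite [(_ + _) ^+ m]exprDn mulr_sumr; apply: eq_bigr => i _.
  rewrite exprMn -muln2 mulnC [_ ^+ (2 * i)]exprM [_ ^+ (m - i).+1]exprS -[_ *+ _]mulr_natl.
  by move: (3 ^+ (m - i)) ((_ ^+ 2) ^+ (m - i)) ((_ ^+ 2) ^+ i) => s t u; ring.
rewrite horner_sum mulr_sumr; apply: eq_bigr => i _.
have [_ _ ->] := hw i.
rewrite hornerZ hornerM hornerXn.
by move: (_ ^+ (m - i).+1) (_ ^+ (m - i)) => s t; ring.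
Qed.

End DihedralForm.

(** * Lambert series of odd powers are quasimodular *)

Section QuasimodularPowerSums.
Variable R : realType.
Local Notation C := R[i].
Local Notation disc := (unit_disc R).

Lemma quasimodular_scale (c : C) (f : disc -> C) :
  quasimodular f -> quasimodular (fun q => c * f q).
Proof. by move=> fq; apply: quasimodular_mul => //; exact: quasimodular_cst. Qed.

Lemma quasimodular_sum (I : Type) (r : seq I) (P : pred I) (f : I -> disc -> C) :
  (forall i, P i -> quasimodular (f i)) ->
  quasimodular (fun q => \sum_(i <- r | P i) f i q).
Proof.
move=> fq; elim: r => [|i r IH].
  rewrite (_ : (fun q => _) = fun=> 0); first exact: quasimodular_cst.
  by apply/funext => q; rewrite big_nil.
case Pi: (P i).
  rewrite (_ : (fun q => _) = fun q => f i q + \sum_(i <- r | P i) f i q).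
    by apply: quasimodular_add => //; exact: fq.
  by apply/funext => q; rewrite big_cons Pi.
rewrite (_ : (fun q => _) = fun q => \sum_(i <- r | P i) f i q)//.
by apply/funext => q; rewrite big_cons Pi.
Qed.

Definition power_lambert (k : nat) (q : disc) : C :=
  lambert (val q) (fun n => n%:R ^+ k).

Lemma has_sum_limn (f : nat -> C) (s : C) :
  has_sum (fun n => f n.+1) s ->
  limn (fun N : nat => \sum_(1 <= n < N) f n : C^o) = s.
Proof.
move=> fs; apply: (@cvg_lim C^o) => //.
apply/cvgrPdist_lt => e e0; have [A hA] := fs e e0.
have [M AM] := fset_iota_cofinal A.
exists M.+1 => // -[//|N] /=; rewrite ltnS => MN.
have -> : \sum_(1 <= n < N.+1) f n = \sum_(i <- fset_iota N) f i.+1.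
  by rewrite big_add1 /= big_mkord (sum_fset_iota N (fun i => f i.+1)).
exact: hA (AM N MN).
Qed.

Lemma eisenstein_seriesE (c : C) (r : nat) (q : disc) :
  eisenstein_series c r q = 1 + c * power_lambert r q.
Proof.
congr (1 + c * _); apply: has_sum_limn; exact: lambert_divisor_sigma (valP q) r.
Qed.

Lemma quasimodular_power_lambert_eisenstein (c : C) (r : nat) : c != 0 ->
  quasimodular (@eisenstein_series R c r) -> quasimodular (power_lambert r).
Proof.
move=> c0 Eq.
have -> : power_lambert r = fun q => c^-1 * (eisenstein_series c r q + (-1)).
  by apply/funext => q; rewrite eisenstein_seriesE addrC addKr mulKf.
apply: quasimodular_scale; apply: quasimodular_add => //.
exact: quasimodular_cst.
Qed.

Definition dihedral_form_nat (m a b : nat) : C := dihedral_form m a%:R b%:R.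

Definition dihedral_form_natN (m a b : nat) : C := dihedral_form m a%:R (- b%:R).

Lemma abs_summable_double_power (q : disc) (i j : nat) :
  abs_summable (double_term (val q) (fun a b => a%:R ^+ i * b%:R ^+ j)).
Proof.
by apply: abs_summable_double_mul; exact: abs_summable_lambert_power (valP q) _.
Qed.

(** Bilinear expansion of a double series into products of Lambert series.  The
expansion of F is only required where the first argument is positive, as it is
obtained by dividing by that argument. *)
Lemma double_term_sum (q : disc) (n : nat) (P : pred nat) (c : nat -> C)
    (e e' : nat -> nat) (F : nat -> nat -> C) :
  (forall a b, F a.+1 b =
    \sum_(i < n | P i) c i * (a.+1%:R ^+ e i * b%:R ^+ e' i)) ->
  abs_summable (double_term (val q) F) /\
  double_lambert (val q) F =
    \sum_(i < n | P i) c i * (power_lambert (e i) q * power_lambert (e' i) q).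
Proof.
move=> FE.
have ps i := abs_summable_double_power q (e i) (e' i).
have FE' : double_term (val q) F = fun p => \sum_(i < n | P i)
    c i * double_term (val q) (fun a b => a%:R ^+ e i * b%:R ^+ e' i) p.
  apply/funext => -[[a b] [x y]]; rewrite /double_term /= FE mulr_suml.
  by apply: eq_bigr => i _; rewrite [RHS]mulrA.
split; rewrite ?/double_lambert FE'.
  by apply: abs_summable_sum => i _; apply: abs_summableZ (ps _).
rewrite tsum_sum; last by move=> i _; apply: abs_summableZ (ps _).
apply: eq_bigr => i _; rewrite tsumZ//; congr (_ * _).
by apply: double_lambert_mul; exact: abs_summable_lambert_power (valP q) _.
Qed.

(** [double_lambert_exchange] for the dihedral form of degree 2m + 6: the double series of
the difference F - G factors monomial by monomial, and the convolution is an odd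
polynomial of degree 2m + 7. *)
Lemma power_lambert_relation (m : nat) : exists (c : nat -> C) (r : {poly C}),
  size r = m.+4 /\ forall q : disc,
  \sum_(i < m.*2.+3 | odd i)
    c i * (power_lambert (m.*2.+4 - i) q * power_lambert i.+2 q) =
  \sum_(j < m.+4) r`_j * power_lambert j.*2.+1 q.
Proof.
have [r [sr hr]] := @dihedral_form_sum_poly C m.
have [c hc] := @dihedral_form_expand C m.
have [d hd] := @dihedral_form_diff C m.
exists d, r; split=> // q.
have n0 (a : nat) : a.+1%:R != 0 :> C by rewrite pnatr_eq0.
have [Fs _] := @double_term_sum q _ xpredT c
  (fun i => m.*2.+4 - i)%N (fun i => i.+2)
  (dihedral_form_nat m) (fun a b => hc _ b%:R (n0 a)).
have [|Gs _] := @double_term_sum q m.*2.+3 xpredT (fun i => c i * (-1) ^+ i)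
    (fun i => m.*2.+4 - i)%N (fun i => i.+2) (dihedral_form_natN m).
  move=> a b; rewrite /dihedral_form_natN hc//; apply: eq_bigr => i _.
  rewrite [(- b%:R) ^+ _]exprNn [(-1) ^+ i.+2]exprS [(-1) ^+ i.+1]exprS.
  by move: (a.+1%:R ^+ _) (b%:R ^+ _) ((-1) ^+ i) => s t u; ring.
have [Ds DE] := @double_term_sum q _ odd d
  (fun i => m.*2.+4 - i)%N (fun i => i.+2)
  (fun a b => dihedral_form_nat m a b - dihedral_form_natN m a b)
  (fun a b => hd _ b%:R (n0 a)).
rewrite -sr -(lambert_odd_poly (valP q)) -DE.
have -> : (fun n => n%:R * r.[n%:R ^+ 2])
    = (fun n => \sum_(a < n.+1) dihedral_form_nat m a (n - a)%N).
  by apply/funext => n; rewrite hr.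
have := double_lambert_exchange (F := dihedral_form_nat m)
  (G := dihedral_form_natN m) _ _ _ _ Fs Gs.
have -> : double_lambert (val q) (dihedral_form_nat m) =
    double_lambert (val q)
      (fun a b => dihedral_form_nat m a b - dihedral_form_natN m a b)
    + double_lambert (val q) (dihedral_form_natN m).
  rewrite /double_lambert -tsumD//; congr tsum; apply/funext => -[[a b] [x y]].
  by rewrite /double_term -mulrDl subrK.
move=> h; apply: (addIr (double_lambert (val q) (dihedral_form_natN m))).
rewrite h; first by rewrite addrC.
- by move=> a b; exact: dihedral_formC.
- by move=> a b; rewrite /dihedral_form_natN -dihedral_formN opprK dihedral_formC.
- by move=> a b; rewrite /dihedral_form_natN natrD dihedral_form_shift.
- by move=> a; exact: dihedral_form0.
Qed.

(** The top coefficient of the polynomial in [power_lambert_relation] is nonzero, and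
the indices of all other Lambert series there are odd and smaller. *)
Lemma quasimodular_power_lambert (j : nat) : quasimodular (power_lambert j.*2.+1).
Proof.
elim/ltn_ind: j => j IH.
case: j IH => [|[|[|m]]] IH.
- apply: quasimodular_power_lambert_eisenstein (@quasimodular_E2 R).
  by rewrite oppr_eq0 pnatr_eq0.
- apply: quasimodular_power_lambert_eisenstein (@quasimodular_E4 R).
  by rewrite pnatr_eq0.
- apply: quasimodular_power_lambert_eisenstein (@quasimodular_E6 R).
  by rewrite oppr_eq0 pnatr_eq0.
have [c [r [sr rel]]] := power_lambert_relation m.
have r0 : r`_m.+3 != 0.
  rewrite (_ : r`_m.+3 = lead_coef r); last by rewrite lead_coefE sr.
  by rewrite lead_coef_eq0 -size_poly_eq0 sr.
rewrite (_ : power_lambert _ = fun q => (r`_m.+3)^-1 *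
  (\sum_(i < m.*2.+3 | odd i)
    c i * (power_lambert (m.*2.+4 - i) q * power_lambert i.+2 q)
   + (-1) * \sum_(j < m.+3) r`_j * power_lambert j.*2.+1 q)); last first.
  by apply/funext => q; rewrite rel big_ord_recr /= mulN1r addrAC subrr add0r mulKf.
have IHodd k : odd k -> (k < m.*2.+4)%N -> quasimodular (power_lambert k).
  move=> ko km; have -> : k = (k./2).*2.+1 by rewrite -{1}(odd_double_half k) ko.
  by apply: IH; rewrite -ltn_double; lia.
apply: quasimodular_scale; apply: quasimodular_add.
  apply: quasimodular_sum => -[i im] /= io.
  apply: quasimodular_scale; apply: quasimodular_mul; apply: IHodd.
  - by rewrite oddB /= ?odd_double ?io//; lia.
  - by case: i io {im} => // i _; lia.
  - by rewrite /= negbK.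
  - by lia.
apply: quasimodular_scale; apply: quasimodular_sum => i _.
by apply: quasimodular_scale; apply: IH.
Qed.

Lemma quasimodular_lambert_odd_poly (r : {poly C}) :
  quasimodular (fun q : disc => lambert (val q) (fun n => n%:R * r.[n%:R ^+ 2])).
Proof.
rewrite (_ : (fun q => _) =
  fun q => \sum_(j < size r) r`_j * power_lambert j.*2.+1 q).
  apply: quasimodular_sum => j _; apply: quasimodular_scale.
  exact: quasimodular_power_lambert.
by apply/funext => q; exact: lambert_odd_poly (valP q) r.
Qed.

End QuasimodularPowerSums.

(** * Newton's identities and increasing sequences *)

Section Newton.
Variable K : comNzRingType.

Fixpoint elem_sym (u : nat -> K) (M k : nat) : K :=
  match M, k with
  | 0, 0 => 1
  | 0, _.+1 => 0
  | M'.+1, 0 => elem_sym u M' 0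
  | M'.+1, k'.+1 => elem_sym u M' k'.+1 + u M' * elem_sym u M' k'
  end.

Lemma elem_sym0 (u : nat -> K) (M : nat) : elem_sym u M 0 = 1.
Proof. by elim: M. Qed.

(** Induction on the number M of variables: the terms in which only the last variable
occurs in the power sum telescope. *)
Lemma newton_identity (u : nat -> K) (M k : nat) :
  k.+1%:R * elem_sym u M k.+1 =
  \sum_(i < k.+1) (-1) ^+ i * elem_sym u M (k - i) * \sum_(n < M) u n ^+ i.+1.
Proof.
elim: M k => [|M IH] k.
  by rewrite mulr0 big1// => i _; rewrite big_ord0 mulr0.
pose e j := if (j <= k)%N then (-1) ^+ j * elem_sym u M (k - j) * u M ^+ j.+1 else 0.
have tele : \sum_(i < k.+1) (e i - e i.+1) = u M * elem_sym u M k.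
  rewrite -(big_mkord xpredT (fun i => e i - e i.+1)).
  rewrite (@telescope_sumr_eq _ _ _ (fun i => - e i))//; last by move=> i _; ring.
  by rewrite /e ltnn leq0n subn0; ring.
have step (i : nat) : (i < k.+1)%N ->
    (-1) ^+ i * elem_sym u M.+1 (k - i) * \sum_(n < M.+1) u n ^+ i.+1 =
    (-1) ^+ i * elem_sym u M (k - i) * \sum_(n < M) u n ^+ i.+1
    + (if (i < k)%N then
        u M * ((-1) ^+ i * elem_sym u M (k.-1 - i) * \sum_(n < M) u n ^+ i.+1) else 0)
    + (e i - e i.+1).
  rewrite ltnS leq_eqVlt => /orP[/eqP ->|ik].
    rewrite ltnn /e leqnn ltnn subnn !elem_sym0 big_ord_recr /=; ring.
  rewrite ik /e (ltnW ik) ik big_ord_recr /= (_ : k - i = (k.-1 - i).+1)%N; last by lia.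
  rewrite (_ : k - i.+1 = k.-1 - i)%N; last by lia.
  by rewrite /= [u M ^+ i.+2]exprS [(-1) ^+ i.+1]exprS; ring.
rewrite (eq_bigr _ (fun (i : 'I_k.+1) _ => step i (ltn_ord i))) 2!big_split /= tele -IH.
rewrite big_ord_recr /= ltnn addr0.
have -> : \sum_(i < k) (if (i < k)%N then
    u M * ((-1) ^+ i * elem_sym u M (k.-1 - i) * \sum_(n < M) u n ^+ i.+1) else 0)
    = u M * (k%:R * elem_sym u M k).
  case: k {e tele step} => [|k]; first by rewrite big_ord0 mul0r mulr0.
  by rewrite IH mulr_sumr; apply: eq_bigr => i _; rewrite ltn_ord.
by rewrite -natr1; ring.
Qed.

End Newton.

Lemma elem_sym_le_power (K : numDomainType) (u : nat -> K) (M k : nat) :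
  (forall n, 0 <= u n) -> elem_sym u M k <= (\sum_(n < M) u n) ^+ k.
Proof.
move=> u0; elim: M k => [|M IH] [|k]; rewrite ?elem_sym0 ?expr0//.
  by rewrite big_ord0 expr0n.
rewrite big_ord_recr /= exprS.
have s0 : 0 <= \sum_(n < M) u n by apply: sumr_ge0.
have h : (\sum_(n < M) u n) ^+ k <= (\sum_(n < M) u n + u M) ^+ k.
  by apply: lerXn2r; rewrite ?nnegrE ?addr_ge0// lerDl.
rewrite mulrDl lerD//.
  by apply: le_trans (IH k.+1) _; rewrite exprS ler_wpM2l.
by rewrite ler_wpM2l// (le_trans (IH k)).
Qed.

(** Increasing sequences of length k with entries in 1, ..., M, built by the recursion
that defines [elem_sym]. *)
Fixpoint incr_seqs (M k : nat) : seq (seq nat) :=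
  match M, k with
  | 0, 0 => [:: [::]]
  | 0, _.+1 => [::]
  | M'.+1, 0 => [:: [::]]
  | M'.+1, k'.+1 => incr_seqs M' k'.+1 ++ [seq rcons s M'.+1 | s <- incr_seqs M' k']
  end.

Lemma mem_incr_seqs (M k : nat) (s : seq nat) :
  (s \in incr_seqs M k) = [&& size s == k, path ltn 0%N s & (last 0%N s <= M)%N].
Proof.
elim: M k s => [|M IH] [|k] s.
- case/lastP: s => // s x; rewrite size_rcons rcons_path last_rcons inE.
  by case: s.
- case/lastP: s => // s x; rewrite size_rcons rcons_path last_rcons in_nil.
  by case: x => [|x]; rewrite !andbF.
- by case: s.
rewrite /= mem_cat IH; case/lastP: s => [|s x].
  by apply/mapP => -[s _]; case: s.
rewrite size_rcons eqSS rcons_path last_rcons [(x <= M.+1)%N]leq_eqVlt ltnS.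
rewrite -cats1; have -> : (s ++ [:: x] \in [seq rcons t M.+1 | t <- incr_seqs M k])
    = (x == M.+1) && (s \in incr_seqs M k).
  apply/mapP/andP => [[t tM]|[/eqP -> sM]]; last by exists s; rewrite ?cats1.
  by rewrite cats1 => /rcons_inj[-> ->]; rewrite eqxx.
rewrite IH; case: (x =P M.+1) => [->|_] /=; last by rewrite orbF.
by rewrite ltnn !andbF /= ltnS andbT.
Qed.

Lemma uniq_incr_seqs (M k : nat) : uniq (incr_seqs M k).
Proof.
elim: M k => [|M IH] [|k] //=.
rewrite cat_uniq IH map_inj_uniq ?IH ?andbT /=; last by move=> s t /rcons_inj[].
apply/hasPn => _ /mapP[s _ ->]; rewrite mem_incr_seqs last_rcons ltnn.
by rewrite !andbF.
Qed.

Lemma sum_incr_seqs (K : comNzRingType) (v : nat -> K) (M k : nat) :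
  \sum_(s <- incr_seqs M k) \prod_(x <- s) v x = elem_sym (fun n => v n.+1) M k.
Proof.
elim: M k => [|M IH] [|k] /=.
- by rewrite big_seq1 big_nil.
- by rewrite big_nil.
- by rewrite big_seq1 big_nil elem_sym0.
rewrite big_cat /= IH big_map; congr (_ + _); rewrite -IH mulr_sumr.
by apply: eq_bigr => s _; rewrite -cats1 big_cat big_seq1 mulrC.
Qed.

(** * MacMahon's series *)

Section MacMahon.
Variable R : realType.
Local Notation C := R[i].
Local Notation disc := (unit_disc R).

(** The quantity u_m for m = n + 1. *)
Definition mac_term (q : C) (n : nat) : C := q ^+ n.+1 / (1 - q ^+ n.+1) ^+ 2.

(** (2i + 1)! C(n + i, 2i + 1) = n (n^2 - 1^2) ... (n^2 - i^2). *)
Lemma binomial_odd_poly (i : nat) : exists r : {poly C},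
  forall n : nat, 'C(n + i, i.*2.+1)%:R = n%:R * r.[n%:R ^+ 2].
Proof.
elim: i => [|i [r IH]].
  by exists 1 => n; rewrite addn0 bin1 hornerC mulr1.
exists (((i.*2.+3)%:R * (i.*2.+2)%:R)^-1 *: (r * ('X - (i.+1%:R ^+ 2)%:P))) => n.
have d0 : (i.*2.+3)%:R * (i.*2.+2)%:R != 0 :> C by rewrite mulf_neq0// pnatr_eq0.
apply: (mulfI d0); rewrite hornerZ [RHS]mulrCA (mulVKf d0) hornerM hornerXsubC.
rewrite mulrA -IH.
rewrite mulrAC -natrM addnS doubleS -[i.*2.+3]/(i.*2.+2.+1) -mul_bin_diag /= natrM.
rewrite -mulrA [_ * (i.*2.+2)%:R]mulrC -natrM mul_bin_left natrM.
have [ni|ni] := ltnP (n + i) i.*2.+1; first by rewrite bin_small// !(mulr0, mul0r).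
by rewrite natrB// -!natr1 -addnn !natrD; ring.
Qed.

Variable q : C.
Hypothesis q1 : `|q| < 1.

Lemma norm_exp_lt1 (n : nat) : `|q ^+ n.+1| < 1.
Proof. by rewrite normrX exprn_ilt1. Qed.

(** Expand x^(i+1) / (1 - x)^(2i+2) at x = q^m and sum over m; the binomial coefficients
C(n + i, 2i + 1) vanish for n <= i, which accounts for the two shifts of the index. *)
Lemma has_sum_mac_term_power (i : nat) :
  has_sum (fun n => mac_term q n ^+ i.+1)
    (lambert q (fun n => 'C(n + i, i.*2.+1)%:R)).
Proof.
have [r hr] := binomial_odd_poly i.
have Ls : abs_summable (lambert_term q (fun n => 'C(n + i, i.*2.+1)%:R)).
  rewrite (_ : (fun n => _) = fun n => n%:R * r.[n%:R ^+ 2]).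
    exact: abs_summable_lambert_odd_poly q1 r.
  by apply/funext => n; rewrite hr.
pose swap (p : nat * nat) := (p.2, p.1).
have swapK : involutive swap by case.
have swapI := can_inj swapK.
rewrite /lambert -(tsum_bij swapK swapK Ls).
apply: eq_has_sum (tsum_pair (abs_summable_inj swapI Ls)) => x.
rewrite /lambert_term /=; set y := q ^+ x.+1.
have y1 : `|y| < 1 := norm_exp_lt1 x.
pose h n := 'C(n + i, i.*2.+1)%:R * y ^+ n.
have hs : abs_summable h.
  apply: abs_summable_le (abs_summable_binomial y1 i.*2.+1) => n.
  rewrite /h !normrM ler_wpM2r// !normr_nat ler_nat leq_bin2l//; lia.
have -> : (fun n => 'C(n.+1 + i, i.*2.+1)%:R * q ^+ (n.+1 * x.+1)) = (fun n => h (n + 1)%N).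
  by apply/funext => n; rewrite /h addn1 /y -exprM mulnC.
rewrite tsum_shift//; last first.
  by move=> [|//] _; rewrite /h bin_small ?mul0r//; lia.
rewrite -(tsum_shift (i := i.+1))//; last first.
  by move=> n ni; rewrite /h bin_small ?mul0r//; lia.
have -> : (fun n => h (n + i.+1)%N) =
    (fun n => y ^+ i.+1 * ('C(n + i.*2.+1, i.*2.+1)%:R * y ^+ n)).
  apply/funext => n; rewrite /h [RHS]mulrCA -exprD [(i.+1 + n)%N]addnC.
  by rewrite (_ : n + i.+1 + i = n + i.*2.+1)%N; last by lia.
rewrite (tsumZ _ (abs_summable_binomial y1 _)) tsum_binomial//.
rewrite /mac_term -/y expr_div_n -[(_ ^+ 2) ^+ _]exprM; congr (_ * _ ^- _); lia.
Qed.

Lemma abs_summable_mac_term : abs_summable (mac_term q).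
Proof.
apply: abs_summable_le
  (abs_summableZ ((1 - `|q|) ^- 2) (abs_summable_binomial q1 0)) => n.
have h0 : 0 < 1 - `|q| by rewrite subr_gt0.
have h1 : 1 - `|q| <= `|1 - q ^+ n.+1|.
  rewrite (le_trans _ (lerB_dist _ _))// normr1 lerD2l lerN2 normrX.
  by rewrite exprS ler_piMr// exprn_ile1// ltW.
rewrite bin0 mul1r /mac_term normrM [leRHS]normrM [leRHS]mulrC.
apply: ler_pM => //.
  by rewrite exprS normrM ler_piMl// ltW.
rewrite !normfV !normrX (ger0_norm (ltW h0)) lef_pV2 ?posrE ?exprn_gt0//.
  by apply: lerXn2r; rewrite ?nnegrE ?normr_ge0 ?(ltW h0).
exact: lt_le_trans h0 h1.
Qed.

End MacMahon.

Section MacMahonQuasimodular.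
Variable R : realType.
Local Notation C := R[i].
Local Notation disc := (unit_disc R).

Definition converges_to (u : nat -> C) (s : C) : Prop :=
  ((u : nat -> C^o) @ \oo --> (s : C^o))%classic.

Lemma converges_to_unique (u : nat -> C) (s t : C) :
  converges_to u s -> converges_to u t -> s = t.
Proof.
move=> us ut; have haus := @norm_hausdorff _ C^o.
by rewrite -(cvg_lim haus us) -(cvg_lim haus ut).
Qed.

Lemma has_sum_converges_to (f : nat -> C) (s : C) : has_sum f s ->
  converges_to (fun M => \sum_(n < M) f n) s.
Proof.
move=> fs; apply/cvgrPdist_lt => e e0; have [A hA] := fs e e0.
have [M AM] := fset_iota_cofinal A.
by exists M => // N /= MN; rewrite -sum_fset_iota; exact: hA (AM N MN).
Qed.

Lemma quasimodular_power_sum (i : nat) : exists2 P : disc -> C, quasimodular P &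
  forall q : disc, has_sum (fun n => mac_term (val q) n ^+ i.+1) (P q).
Proof.
have [r hr] := binomial_odd_poly R i.
exists (fun q => lambert (val q) (fun n => n%:R * r.[n%:R ^+ 2])).
  exact: quasimodular_lambert_odd_poly.
move=> q; rewrite -(funext hr); exact: has_sum_mac_term_power (valP q) i.
Qed.

(** Newton's identities pass to the limit in the number of variables. *)
Lemma quasimodular_elem_sym_lim (k : nat) : exists2 a : disc -> C, quasimodular a &
  forall q : disc, converges_to (fun M => elem_sym (mac_term (val q)) M k) (a q).
Proof.
elim/ltn_ind: k => -[|k] IH.
  exists (fun=> 1); first exact: quasimodular_cst.
  move=> q; rewrite (_ : (fun M => _) = fun=> 1); first exact: cvg_cst.
  by apply/funext => M; rewrite elem_sym0.
have /choice[a ha] : forall j, exists a : disc -> C, (j < k.+1)%N ->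
    quasimodular a /\
    forall q : disc, converges_to (fun M => elem_sym (mac_term (val q)) M j) (a q).
  move=> j; case: (ltnP j k.+1) => [/IH[a aq ac]|_]; first by exists a.
  by exists (fun=> 0).
have /choice[P hP] : forall i, exists P : disc -> C, quasimodular P /\
    forall q : disc, has_sum (fun n => mac_term (val q) n ^+ i.+1) (P q).
  by move=> i; have [P] := quasimodular_power_sum i; exists P.
exists (fun q => k.+1%:R^-1 *
    \sum_(i < k.+1) ((-1) ^+ i * a (k - i)%N q) * P i q).
  apply: quasimodular_scale; apply: quasimodular_sum => i _.
  apply: quasimodular_mul; last exact: (hP i).1.
  apply: quasimodular_scale; apply: (ha _ _).1.
  by rewrite ltnS leq_subr.
move=> q.
rewrite (_ : (fun M => _) = fun M => k.+1%:R^-1 * \sum_(i < k.+1)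
  (-1) ^+ i * elem_sym (mac_term (val q)) M (k - i) * \sum_(n < M) mac_term (val q) n ^+ i.+1); last first.
  by apply/funext => M; rewrite -newton_identity mulKf// pnatr_eq0.
apply: cvgM; first exact: cvg_cst.
apply: cvg_big => [|i _]; first exact: add_continuous.
apply: cvgM; last exact: has_sum_converges_to ((hP i).2 q).
apply: cvgM; first exact: cvg_cst.
apply: (ha _ _).2.
by rewrite ltnS leq_subr.
Qed.

End MacMahonQuasimodular.

Section IncreasingTuples.
Variable k : nat.

Definition seq_of_increasing (m : increasing_tuple k) : seq nat := val (val m).

(** Transports the explicit enumeration [incr_seqs] to the index type of the series,
as a partial inverse of [seq_of_increasing]. *)
Definition increasing_of_seq (s : seq nat) : option (increasing_tuple k) :=
  obind insub (insub s : option (k.-tuple nat)).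

Definition increasing_tuples (M : nat) : {fset increasing_tuple k} :=
  [fset m in pmap increasing_of_seq (incr_seqs M k)].

Lemma seq_of_increasingK : pcancel seq_of_increasing increasing_of_seq.
Proof. by move=> m; rewrite /increasing_of_seq valK /= valK. Qed.

Lemma increasing_of_seqK : ocancel increasing_of_seq seq_of_increasing.
Proof.
move=> s; rewrite /increasing_of_seq /=; case: insubP => //= t _ ts.
by case: insubP => //= m _ mt; rewrite /seq_of_increasing -ts -mt.
Qed.

Lemma map_increasing_of_seq (M : nat) :
  map seq_of_increasing (pmap increasing_of_seq (incr_seqs M k)) = incr_seqs M k.
Proof.
rewrite (pmap_filter increasing_of_seqK); apply/all_filterP/allP => s.
rewrite mem_incr_seqs => /and3P[sk ps _].
by rewrite /increasing_of_seq /= (insubT (fun s : seq nat => size s == k) sk) /= insubT.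
Qed.

Lemma sum_increasing_tuples (K : comNzRingType) (v : nat -> K) (M : nat) :
  \sum_(m <- increasing_tuples M) \prod_(x <- seq_of_increasing m) v x =
  elem_sym (fun n => v n.+1) M k.
Proof.
rewrite -sum_incr_seqs -[in RHS]map_increasing_of_seq big_map; apply: perm_big.
apply: uniq_perm; first exact: fset_uniq.
  by apply: (pmap_uniq increasing_of_seqK); exact: uniq_incr_seqs.
by move=> m; rewrite !inE.
Qed.

Lemma increasing_tuples_cofinal (A : {fset increasing_tuple k}) :
  exists N, forall M, (N <= M)%N -> A `<=` increasing_tuples M.
Proof.
exists (\max_(m <- A) last 0%N (seq_of_increasing m))%N => M AM.
apply/fsubsetP => m mA; rewrite in_fset -[in_mem _ _]/(m \in pmap _ _).
rewrite mem_pmap -seq_of_increasingK map_f// mem_incr_seqs.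
rewrite size_tuple eqxx (valP m) /=; apply: leq_trans AM.
by rewrite (big_fsetD1 m mA) /= leq_maxl.
Qed.

End IncreasingTuples.

Section MacMahonLimit.
Variable R : realType.
Local Notation C := R[i].

(** The tuples with entries at most M exhaust the index set, and their partial sum is the
elementary symmetric function of u_1, ..., u_M.  Absolute convergence follows from
e_k(|u|) <= (|u_1| + |u_2| + ...)^k. *)
Lemma MacMahonA_lim (k : nat) (q : unit_disc R) :
  converges_to (fun M => elem_sym (mac_term (val q)) M k) (MacMahonA k q).
Proof.
pose v (x : nat) : C := val q ^+ x / (1 - val q ^+ x) ^+ 2.
pose f (m : increasing_tuple k) : C := \prod_(x <- seq_of_increasing m) v x.
have -> : MacMahonA k q = tsum f.
  by congr tsum; apply/funext => m; rewrite /f [RHS]big_tuple.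
have [B hB] := abs_summable_mac_term (valP q).
have fs : abs_summable f.
  exists (B ^+ k) => A; have [N AN] := increasing_tuples_cofinal A.
  apply: le_trans (ler_sum_fset (AN N (leqnn N)) _) _; first by [].
  rewrite (_ : \sum_(m <- _) _ = elem_sym (fun n => `|mac_term (val q) n|) N k).
    apply: le_trans (elem_sym_le_power _ _ _) _ => //.
    apply: lerXn2r; rewrite ?nnegrE ?sumr_ge0//.
      by apply: le_trans (hB fset0); rewrite big_seq_fset0.
    by rewrite -(sum_fset_iota N (fun n => `|mac_term (val q) n|)).
  rewrite -(sum_increasing_tuples k (fun x => `|v x|) N).
  by apply: eq_bigr => m _; rewrite normr_prod.
apply/cvgrPdist_lt => e e0.
have [A hA] := abs_summable_has_sum fs e0.
have [N AN] := increasing_tuples_cofinal A.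
exists N => // M /= NM.
by rewrite -(sum_increasing_tuples k v M); exact: hA (AN M NM).
Qed.

End MacMahonLimit.

Theorem corollary4 (R : realType) (k : nat) (hk : (1 <= k)%N) :
  quasimodular (@MacMahonA R k).
Proof.
have [a aq alim] := quasimodular_elem_sym_lim R k.
rewrite (_ : @MacMahonA R k = a)//; apply/funext => q.
exact: converges_to_unique (@MacMahonA_lim R k q) (alim q).
Qed.
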